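(* Let $q$ be a power of an odd prime, let $d\ge 2$ and $k\in\{1,2,\dots,d\}$ be integers. There is a constant $C>0$, independent of $q$, such that for every subset $E\subset\mathbb{F}_q^d$ with $$|E|\ge C\, q^{\max\{(d+1)/2,\ d-k\}}$$ one has $D_k(E)=\mathbb{F}_q$.
   Context: $\mathbb{F}_q$ denotes the finite field with $q$ elements. For $x=(x_1,\dots,x_d)\in\mathbb{F}_q^d$ put $\|x\|=x_1^2+\cdots+x_d^2$, and let $\mathcal{Z}(x)$ denote the number of coordinates of $x$ equal to $0$. For fixed $k\in\{1,\dots,d\}$ the $k$-norm is defined by $\|x\|_k=\|x\|$ if $0\le \mathcal{Z}(x)\le k-1$, and $\|x\|_k=0$ otherwise. For $E\subset\mathbb{F}_q^d$, the $k$-distance set is $D_k(E)=\{\|x-y\|_k : x,y\in E\}$. *)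

(* Defs.v *)
From HB Require Import structures.
From mathcomp Require Import all_boot all_order all_algebra.
From mathcomp Require Import reals exp.

Set Implicit Arguments.
Unset Strict Implicit.
Unset Printing Implicit Defensive.

Import GRing.Theory.
Local Open Scope ring_scope.

(* The sum of the squares of the coordinates, without square root. *)
Definition sqnorm (F : finFieldType) (d : nat) (x : 'rV[F]_d) : F :=
  \sum_(i < d) x 0 i ^+ 2.

Definition nzeros (F : finFieldType) (d : nat) (x : 'rV[F]_d) : nat :=
  #|[set i : 'I_d | x 0 i == 0]|.

(* Only used for 1 <= k <= d, where the subtraction does not truncate. *)
Definition knorm (F : finFieldType) (d k : nat) (x : 'rV[F]_d) : F :=
  if (nzeros x <= k - 1)%N then sqnorm x else 0.

Definition kdist (F : finFieldType) (d k : nat) (E : {set 'rV[F]_d}) : {set F} :=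
  [set knorm k (x - y) | x in E, y in E].

(* Main.v *)
Require Import Defs.
From HB Require Import structures.
From mathcomp Require Import all_boot all_order all_algebra all_field.
From mathcomp Require Import reals exp.
From mathcomp Require Import zify ring.

(* Call a pair (x, y) in E^2 with ||x - y|| = t <> 0 bad if x - y has at least k
   zero coordinates. Splitting by the zero set, there are at most
   2^(d+1) q^(d-k-1) |E| bad pairs, whereas Iosevich and Rudnev's theorem gives
   |E|^2/q + O(q^((d-1)/2) |E|) pairs at distance t in all. The error term is a
   Fourier coefficient of the sphere, that is, a Salie sum for odd d (evaluated
   explicitly) and a Kloosterman sum for even d.

   The bound K^2 <= 4 q for Kloosterman sums K goes as follows. If F' is the
   quadratic extension of a field F of size q, then K_{F'} = 2 q - K_F^2, since any
   pair (t, n) is the (trace, norm) of some elements of F' and the (sum, product) of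
   some pairs over F, exactly two in total. If K^2 > 4 q then, along a tower of
   quadratic extensions F_j with q_j elements, -K_j / sqrt q_j tends to infinity.
   The sum of -K_j over all characters s.psi (s <> 0 in F) bounds each -K_j from above,
   since all its terms are at least -2 sqrt q_j; and it is O(sqrt q_j) because the
   Artin-Schreier curves y^q - y = a x + b / x - c have at most q_j + O(sqrt q_j)
   points. This last estimate is Bombieri's form of Stepanov's method: a function
   vanishing at all rational points is found among the combinations of the
   (x^k y^l) (x^i y^j)^r with r = sqrt q_j by linear algebra, using y^r = y + A(x). *)

Set Implicit Arguments.
Unset Strict Implicit.
Unset Printing Implicit Defensive.
Import Order.TTheory GRing.Theory Num.Theory.
Local Open Scope ring_scope.

(** * Stepanov's method *)

Lemma homogeneous_system_nontrivial (K : fieldType) (T U : finType)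
    (M : T -> U -> K) : (#|U| < #|T|)%N ->
  exists e : T -> K, (exists t, e t != 0) /\ forall u, \sum_t e t * M t u = 0.
Proof.
move=> ltUT.
pose A : 'M[K]_(#|T|, #|U|) := \matrix_(i, j) M (enum_val i) (enum_val j).
have : ~~ row_free A.
  by rewrite /row_free neq_ltn (leq_ltn_trans (rank_leq_col A) ltUT).
rewrite -kermx_eq0 => /rowV0Pn [v /sub_kermxP vA /rV0Pn [i vi]].
exists (fun t => v 0 (enum_rank t)); split.
  by exists (enum_val i); rewrite enum_valK.
move=> u; have /matrixP/(_ 0 (enum_rank u)) := vA.
rewrite !mxE (reindex (@enum_rank T)) /=; last first.
  by apply: onW_bij; exists enum_val; [exact: enum_rankK | exact: enum_valK].
by move=> E; rewrite -[RHS]E; apply: eq_bigr => t _; rewrite mxE !enum_rankK.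
Qed.

(** Among the terms with nonzero coefficient, the one of largest degree cannot be cancelled by the
    others. *)
Lemma sum_distinct_degrees_neq0 (K : fieldType) (T : finType) (c : T -> K)
    (P : T -> {poly K}) (w : T -> nat) :
    injective w -> (forall t, size (P t) = (w t).+1) -> (exists t, c t != 0) ->
  \sum_t c t *: P t != 0.
Proof.
move=> winj szP [t0 ct0].
case: (@arg_maxnP _ t0 (fun t => c t != 0) w ct0) => t ct tmax.
apply: contraNneq ct => S0.
have /eqP : (\sum_i c i *: P i)`_(w t) = 0 by rewrite S0 coef0.
rewrite coef_sum (bigD1 t) //= big1 ?addr0 => [|i it].
  rewrite coefZ mulf_eq0 => /orP[// | ].
  have -> : (P t)`_(w t) = lead_coef (P t) by rewrite lead_coefE szP.
  by rewrite lead_coef_eq0 -size_poly_eq0 szP.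
rewrite coefZ; have [-> | ci] := eqVneq (c i) 0; first by rewrite mul0r.
rewrite nth_default ?mulr0 // szP ltn_neqAle; apply/andP; split; last exact: tmax.
by apply: contra it => /eqP/winj->.
Qed.

Section Reduction.

Variables (L : fieldType) (q : nat) (g : {poly L}).

(* The outer variable is [y], the inner one is [x]: modulo the relation
   [x * y^q = x * y + g(x)], [reduce u] equals [x * u]. *)
Definition reduce (u : {poly {poly L}}) : {poly {poly L}} :=
  'X *: take_poly q u + ('X *: 'X + g%:P) * drop_poly q u.

Lemma reduceD u v : reduce (u + v) = reduce u + reduce v.
Proof. by rewrite /reduce take_polyD drop_polyD scalerDr mulrDr addrACA. Qed.

Lemma reduceZ c u : reduce (c *: u) = c *: reduce u.
Proof.
by rewrite /reduce take_polyZ drop_polyZ scalerDr scalerA mulrC -scalerA -scalerAr.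
Qed.

Lemma reduce_sum (I : Type) (s : seq I) (P : pred I) (u : I -> {poly {poly L}}) :
  reduce (\sum_(i <- s | P i) u i) = \sum_(i <- s | P i) reduce (u i).
Proof.
apply: (big_morph reduce reduceD).
by rewrite /reduce take_poly0r drop_poly0r mulr0 scaler0 addr0.
Qed.

Definition eval2 (x y : L) (u : {poly {poly L}}) := u.[y%:P].[x].

Lemma eval2_reduce x y u : x * y ^+ q = x * y + g.[x] ->
  eval2 x y (reduce u) = x * eval2 x y u.
Proof.
move=> xy; rewrite /eval2 /reduce -{3}(poly_take_drop q u) !hornerE.
rewrite mulrDr mulrCA -xy; congr (_ + _); rewrite ?horner_exp ?hornerE /=; ring.
Qed.

Definition xdeg n (u : {poly {poly L}}) := forall b, (size (u`_b)%R <= n.+1)%N.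

Lemma xdeg_leq n m u : (n <= m)%N -> xdeg n u -> xdeg m u.
Proof. by move=> nm xu b; apply: leq_trans (xu b) _. Qed.

Lemma xdegD n u v : xdeg n u -> xdeg n v -> xdeg n (u + v).
Proof.
move=> xu xv b; rewrite coefD (leq_trans (size_polyD _ _)) // geq_max.
by rewrite xu xv.
Qed.

Lemma xdeg_sum n (I : Type) (s : seq I) (P : pred I) (u : I -> {poly {poly L}}) :
  (forall i, P i -> xdeg n (u i)) -> xdeg n (\sum_(i <- s | P i) u i).
Proof.
move=> xu; apply: (big_ind (xdeg n)) => //; last exact: xdegD.
by move=> b; rewrite coef0 size_poly0.
Qed.

Lemma xdegM n m u v : xdeg n u -> xdeg m v -> xdeg (n + m) (u * v).
Proof.
move=> xu xv b; rewrite coefM; apply: (leq_trans (size_sum _ _ _)).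
apply/bigmax_leqP => i _; apply: (leq_trans (size_polyMleq _ _)).
have := xu i; have := xv (b - i)%N; lia.
Qed.

Lemma xdegC (p : {poly L}) n : (size p <= n.+1)%N -> xdeg n p%:P.
Proof. by move=> sp b; rewrite coefC; case: ifP => // _; rewrite size_poly0. Qed.

Lemma xdegZ (p : {poly L}) n m u : (size p <= m.+1)%N -> xdeg n u -> xdeg (m + n) (p *: u).
Proof. by move=> sp xu; rewrite -mul_polyC; apply: xdegM => //; apply: xdegC. Qed.

Lemma xdegXn j : xdeg 0 'X^j.
Proof. by move=> b; rewrite coefXn; case: eqP => _; rewrite ?size_poly1 ?size_poly0. Qed.

Lemma xdeg_exp n u l : xdeg n u -> xdeg (l * n) (u ^+ l).
Proof.
move=> xu; elim: l => [|l IH]; first exact: (xdegXn 0).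
by rewrite exprS mulSn; apply: xdegM.
Qed.

Hypothesis q_gt0 : (0 < q)%N.

(** One reduction suffices for a degree at most [2 q - 2] in [y]: the part above [y^q] has degree at
    most [q - 2] and is multiplied by a polynomial linear in [y]. *)
Lemma size_reduce (u : {poly {poly L}}) : (size u <= q.*2.-1)%N -> (size (reduce u) <= q)%N.
Proof.
move=> szu; apply: (leq_trans (size_polyD _ _)); rewrite geq_max; apply/andP; split.
  by apply: (leq_trans (size_scale_leq _ _)); rewrite size_take_poly.
apply: (leq_trans (size_polyMleq _ _)).
have : (size ('X *: 'X + g%:P : {poly {poly L}})%R <= 2)%N.
  apply: (leq_trans (size_polyD _ _)); rewrite geq_max.
  rewrite (leq_trans (size_scale_leq _ _)) ?size_polyX //=.
  by rewrite size_polyC; case: (g != 0).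
rewrite size_drop_poly; lia.
Qed.

Hypothesis szg : (size g <= 3)%N.

Lemma xdeg_reduce n u : xdeg n u -> xdeg n.+2 (reduce u).
Proof.
move=> xu; apply: xdegD.
  apply: (@xdeg_leq (1 + n)) => //; apply: xdegZ; first by rewrite size_polyX.
  by move=> b; rewrite coef_take_poly; case: ifP => // _; rewrite size_poly0.
rewrite -[n.+2]/(2 + n)%N; apply: xdegM; last by move=> b; rewrite coef_drop_poly.
apply: xdegD; last exact: xdegC.
apply: (@xdeg_leq (1 + 0)) => //; apply: xdegZ; first by rewrite size_polyX.
exact: (xdegXn 1).
Qed.

(* Substituting [x := X^q], [y := X] turns the pole order at infinity, where
   [x] has weight [q] and [y] weight [1], into an ordinary degree. *)
Definition weight_poly (u : {poly {poly L}}) : {poly L} :=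
  (map_poly (comp_poly 'X^q) u).['X].

Lemma weight_polyD u v : weight_poly (u + v) = weight_poly u + weight_poly v.
Proof. by rewrite /weight_poly rmorphD hornerD. Qed.

Lemma weight_polyZ p u : weight_poly (p *: u) = (p \Po 'X^q) * weight_poly u.
Proof. by rewrite /weight_poly map_polyZ hornerZ. Qed.

Lemma weight_poly_sum (I : Type) (s : seq I) (P : pred I) (u : I -> {poly {poly L}}) :
  weight_poly (\sum_(i <- s | P i) u i) = \sum_(i <- s | P i) weight_poly (u i).
Proof.
apply: (big_morph weight_poly weight_polyD).
by rewrite /weight_poly rmorph0 horner0.
Qed.

Lemma weight_polyXn b : weight_poly 'X^b = 'X^b.
Proof. by rewrite /weight_poly map_polyXn hornerXn. Qed.

Lemma size_comp_Xq (p : {poly L}) : p != 0 ->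
  size (p \Po 'X^q) = ((size p).-1 * q).+1.
Proof.
move=> p0; rewrite -[LHS]prednK ?size_comp_poly ?size_polyXn //.
by rewrite size_poly_gt0 comp_poly_eq0 ?size_polyXn.
Qed.

Lemma size_compM_Xn (p : {poly L}) b : p != 0 ->
  size ((p \Po 'X^q) * 'X^b) = ((size p).-1 * q + b).+1.
Proof.
move=> p0; have sp := size_comp_Xq p0.
rewrite size_mulXn ?sp ?addnS 1?addnC // -size_poly_eq0 sp //.
Qed.

Lemma reduceXn_small b : (b < q)%N -> reduce 'X^b = 'X *: 'X^b.
Proof.
move=> bq; have sb : (size ('X^b : {poly {poly L}})%R <= q)%N by rewrite size_polyXn.
by rewrite /reduce take_poly_id // drop_poly_eq0 // mulr0 addr0.
Qed.

Lemma reduceXn_large b : (q <= b)%N ->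
  reduce 'X^b = 'X *: 'X^((b - q).+1) + g *: 'X^(b - q).
Proof.
move=> qb; rewrite /reduce -{1 2}(subnK qb) exprD take_polyMXn_0 drop_polyMXn_id.
by rewrite scaler0 add0r mulrDl -scalerAl -exprS mul_polyC.
Qed.

Lemma size_weight_reduce_small (p : {poly L}) b : p != 0 -> (b < q)%N ->
  size (weight_poly (reduce (p *: 'X^b))) = ((size p).-1 * q + b + q).+1.
Proof.
move=> p0 bq; rewrite reduceZ reduceXn_small // scalerA weight_polyZ weight_polyXn.
rewrite size_compM_Xn ?mulf_neq0 ?polyX_eq0 // size_mulX //=.
by move: p0; rewrite -size_poly_gt0; move: (size p) => n; nia.
Qed.

(** Reduction trades [x * y^q], of weight [2 q], for [x * y + g(x)], whose weight is at most [2 q]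
    because [g] has degree at most 2. *)
Lemma size_weight_reduce (p : {poly L}) b : p != 0 ->
  (size (weight_poly (reduce (p *: 'X^b))) <= ((size p).-1 * q + b + q).+1)%N.
Proof.
move=> p0; have [bq | qb] := ltnP b q; first by rewrite size_weight_reduce_small.
rewrite reduceZ reduceXn_large // scalerDr !scalerA weight_polyD !weight_polyZ.
rewrite !weight_polyXn; apply: (leq_trans (size_polyD _ _)).
rewrite geq_max; apply/andP; split.
  rewrite size_compM_Xn ?mulf_neq0 ?polyX_eq0 // size_mulX //=.
  by move: p0; rewrite -size_poly_gt0; move: (size p) => n; nia.
have [-> | g0] := eqVneq g 0.
  by rewrite mulr0 comp_poly0 mul0r size_poly0.
rewrite size_compM_Xn ?mulf_neq0 // size_mul //.
move: p0 g0; rewrite -!size_poly_gt0; move: szg.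
move: (size p) (size g) => n m; nia.
Qed.

End Reduction.

Lemma add_muln_inj (r a a' b b' : nat) : (a < r)%N -> (a' < r)%N ->
  (a + r * b = a' + r * b')%N -> a = a' /\ b = b'.
Proof.
have modE c d : (c < r)%N -> ((c + r * d) %% r = c)%N.
  by move=> cr; rewrite addnC mulnC modnMDl modn_small.
move=> ar ar' E; have aa : a = a' by rewrite -(modE a b) // E modE.
split=> //; move: E; rewrite aa => /addnI/eqP; rewrite eqn_pmul2l => [/eqP//|]; lia.
Qed.

Lemma size_polyMn_leq (K : fieldType) (p : {poly K}) n : (size (p *+ n) <= size p)%N.
Proof. by apply/leq_sizeP => i ip; rewrite coefMn nth_default ?mul0rn. Qed.

Section Terms.

Variables (L : fieldType) (q D : nat) (g A : {poly L}).
Let r := (q * D)%N.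

(* [x^(e + r) * y^j * (y + A/x^D)^l] with denominators cleared; on the curve it is
   [x^(e + r) * y^(j + r * l)]. *)
Definition curve_term e j l : {poly {poly L}} :=
  'X^(e + D * (q - l)) *: ('X^j * ('X^D *: 'X + A%:P) ^+ l).

Lemma size_linA : (size ('X^D *: 'X + A%:P : {poly {poly L}})%R <= 2)%N.
Proof.
apply: (leq_trans (size_polyD _ _)); rewrite geq_max.
rewrite (leq_trans (size_scale_leq _ _)) ?size_polyX //=.
by rewrite size_polyC; case: (A != 0).
Qed.

Lemma size_curve_term e j l : (j < q)%N -> (l < q)%N ->
  (size (curve_term e j l) <= q.*2.-1)%N.
Proof.
move=> jq lq; apply: (leq_trans (size_scale_leq _ _)).
apply: (leq_trans (size_polyMleq _ _)); rewrite size_polyXn.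
have := size_poly_exp_leq ('X^D *: 'X + A%:P : {poly {poly L}}) l.
have := size_linA; move: (size _) (size _) => s1 s2; nia.
Qed.

Lemma eval2_curve_term x y e j l : (l <= q)%N ->
    A.[x] = x ^+ D * (y ^+ r - y) ->
  eval2 x y (curve_term e j l) = x ^+ (e + r) * y ^+ (j + r * l).
Proof.
move=> lq Ax; rewrite /eval2 /curve_term !hornerE ?horner_exp ?hornerE /=.
rewrite Ax -mulrDr addrC subrK exprMn -!exprM mulrACA -exprD -exprD.
by congr (x ^+ _ * _); rewrite /r; nia.
Qed.

Hypothesis szA : size A = (D.*2).+1.

Lemma xdeg_curve_term e j l : (l < q)%N -> xdeg (e + r.*2 - D) (curve_term e j l).
Proof.
move=> lq; apply: (@xdeg_leq _ ((e + D * (q - l)) + (0 + l * D.*2))); first by rewrite /r; nia.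
apply: xdegZ; first by rewrite size_polyXn.
apply: xdegM; first exact: xdegXn.
apply: xdeg_exp; apply: xdegD; last by apply: xdegC; rewrite szA.
apply: (@xdeg_leq _ (D + 0)); first lia.
by apply: xdegZ; [rewrite size_polyXn | exact: (xdegXn _ 1)].
Qed.

Lemma A_neq0 : A != 0. Proof. by rewrite -size_poly_eq0 szA. Qed.

Lemma size_expA n : size (A ^+ n) = (D.*2 * n).+1.
Proof.
rewrite -[LHS]prednK ?size_exp ?szA //.
by rewrite size_poly_gt0 expf_neq0 ?A_neq0.
Qed.

Lemma curve_term_sum e j l : curve_term e j l =
  \sum_(t < l.+1) ('X^(e + D * (q - l) + D * t) * A ^+ (l - t)) *: 'X^(j + t) *+ 'C(l, t).
Proof.
rewrite /curve_term addrC exprDn mulr_sumr scaler_sumr; apply: eq_bigr => t _.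
rewrite mulrnAr -scalerMnr; congr (_ *+ _).
rewrite exprZn -polyC_exp -scalerAr mul_polyC scalerA -scalerAr -exprD scalerA.
by congr (_ *: _); rewrite -exprM mulrA -exprD.
Qed.

Hypothesis q_gt1 : (1 < q)%N.
Hypothesis D_gt0 : (0 < D)%N.
Hypothesis szg : (size g <= 3)%N.

(** In the binomial expansion of [(x^D * y + A)^l] the term [A^l] dominates strictly, since [A] has
    weight [2 r] and [x^D * y] only [r + 1]. The outcome is the weight of
    [x * x^(e + r) * y^(j + r * l)]. *)
Lemma size_weight_curve_term e j l : (j < q)%N -> (l < q)%N ->
  size (weight_poly q (reduce q g (curve_term e j l))) =
  (q * e + j + r * l + (q + r * q)).+1.
Proof.
move=> jq lq; have q0 : (0 < q)%N by lia.
rewrite curve_term_sum reduce_sum weight_poly_sum.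
have term t : weight_poly q (reduce q g
    (('X^(e + D * (q - l) + D * t) * A ^+ (l - t)) *: 'X^(j + t) *+ 'C(l, t))) =
  weight_poly q (reduce q g
    (('X^(e + D * (q - l) + D * t) * A ^+ (l - t)) *: 'X^(j + t))) *+ 'C(l, t).
  by rewrite -scaler_nat reduceZ weight_polyZ rmorph_nat mulr_natl.
have neq0 t : 'X^(e + D * (q - l) + D * t) * A ^+ (l - t) != 0.
  by rewrite mulf_neq0 ?expf_neq0 ?A_neq0 ?polyX_eq0.
have szp t : size ('X^(e + D * (q - l) + D * t) * A ^+ (l - t)) =
    (e + D * (q - l) + D * t + D.*2 * (l - t)).+1.
  by rewrite mulrC size_mulXn ?expf_neq0 ?A_neq0 // size_expA addnS.
have sz0 : size (weight_poly q (reduce q g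
    (('X^(e + D * (q - l) + D * 0) * A ^+ (l - 0)) *: 'X^(j + 0)))) =
    (q * e + j + r * l + (q + r * q)).+1.
  by rewrite size_weight_reduce_small ?addn0 ?szp ?neq0 //= /r; nia.
rewrite big_ord_recl term /= bin0 mulr1n size_polyDl sz0 //.
apply: (leq_ltn_trans (size_sum _ _ _)); rewrite ltnS; apply/bigmax_leqP => t _.
rewrite term; apply: (leq_trans (size_polyMn_leq _ _)).
apply: (leq_trans (size_weight_reduce _ _ _ _)) => //.
rewrite szp /= /bump /= add1n; have := ltn_ord t; nia.
Qed.

End Terms.

Lemma card_roots_leq (K : finFieldType) (p : {poly K}) (Z : {set K}) : p != 0 ->
  (forall x, x \in Z -> p.[x] = 0) -> (#|Z| < size p)%N.
Proof.
move=> p0 Zp; rewrite cardE; apply: max_poly_roots => //; last exact: enum_uniq.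
by apply/allP => x; rewrite mem_enum => /Zp/eqP.
Qed.

Lemma expr_sum_pchar (K : fieldType) n (I : Type) (s : seq I) (P : pred I) (u : I -> K) :
  [pchar K].-nat n -> (\sum_(i <- s | P i) u i) ^+ n = \sum_(i <- s | P i) u i ^+ n.
Proof.
move=> Kn; apply: (big_morph (fun x => x ^+ n)) => [x y|].
  exact: exprDn_pchar.
by rewrite expr0n; case/andP: Kn => /prednK<-.
Qed.

Section StepanovCore.

Variables (L : finFieldType) (q D : nat) (g A : {poly L}).
Hypothesis q_gt1 : (1 < q)%N.
Hypothesis D_gt0 : (0 < D)%N.
Let r := (q * D)%N.
Hypothesis r_gt2 : (2 < r)%N.
Hypothesis szg : (size g <= 3)%N.
Hypothesis szA : size A = (D.*2).+1.
Hypothesis Lr : [pchar L].-nat r.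
Hypothesis cardL : #|L| = (r ^ 2)%N.

Definition on_curve (x y : L) :=
  [/\ x != 0, x * y ^+ q = x * y + g.[x] & A.[x] = x ^+ D * (y ^+ r - y)].

(** An index [((i, j), (k, l))] stands for [(x^k y^l) (x^i y^j)^r], which is [term] up to the factor
    [x^r]. Since [u^(r^2) = u] in [L], its [r]-th power at a rational point is
    [(x^i y^j) (x^k y^l)^r], which is [dual_term] up to [x^r]. *)
Let T : finType := ('I_(D + 4) * 'I_q * ('I_D * 'I_q))%type.
Let term (t : T) :=
  curve_term q D A (t.2.1 + t.1.1 * r) t.2.2 t.1.2.
Let dual_term (t : T) :=
  curve_term q D A (t.2.1 * r + t.1.1) t.1.2 t.2.2.

Let expr_r2 (x : L) : (x ^+ r) ^+ r = x.
Proof. by rewrite -exprM mulnn -cardL expf_card. Qed.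

(** The unknowns outnumber the coefficients of the reduced sum: there are [(D + 4) q r] of the
    former and [q ((D + 1) r + 6)] of the latter, and [r > 2]. The system is solved for [c^r];
    raising to the power [r] is an involution of [L], so [c] can be recovered. *)
Lemma exists_annihilating_coeffs : exists c : T -> L, (exists t, c t != 0) /\
  \sum_t (c t ^+ r)%:P *: reduce q g (dual_term t) = 0.
Proof.
(* The reduced dual terms have [x]-degree at most [k r + i + 2 r - D + 2], where [k <= D - 1] and
   [i <= D + 3]. *)
pose W := ((D + 1) * r + 6)%N.
have [] := @homogeneous_system_nontrivial L T ('I_q * 'I_W)%type
  (fun t u => (reduce q g (dual_term t))`_u.1`_u.2).
  rewrite !card_prod !card_ord /W /r; move: r_gt2; rewrite /r; nia.
move=> e [[t et] He]; exists (fun t => e t ^+ r); split.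
  by exists t; rewrite expf_neq0.
under eq_bigr do rewrite expr_r2.
apply/polyP => b; rewrite coef0; apply/polyP => n; rewrite coef0 coef_sum.
under eq_bigr do rewrite coefZ.
have [bq | qb] := ltnP b q; last first.
  rewrite big1 ?coef0 // => u _; rewrite nth_default ?mulr0 //.
  apply: leq_trans qb; apply: size_reduce; first by lia.
  exact: size_curve_term.
rewrite coef_sum; under eq_bigr do rewrite coefCM.
have [nW | Wn] := ltnP n W.
  exact: (He (Ordinal bq, Ordinal nW)).
rewrite big1 // => u _; rewrite nth_default ?mulr0 //.
apply: leq_trans Wn; set k := (u.2.1 * r + u.1.1)%N.
have xt : xdeg (k + r.*2 - D) (dual_term u) by exact: xdeg_curve_term.
have := xdeg_reduce q szg xt b; move/leq_trans; apply.
have := ltn_ord u.2.1; have := ltn_ord u.1.1; rewrite /k /W /r; nia.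
Qed.

(** The auxiliary function [h] is nonzero because its terms have distinct weights, yet it vanishes
    at the rational points because its [r]-th power is, up to a power of [x], the annihilated dual
    sum. So its leading coefficient in [y], of degree at most [(D + 5) r + 1], vanishes on [Z]. *)
Lemma stepanov_core (S : {set L}) (Z : {set L}) : (q <= #|S|)%N ->
    (forall x, x \in Z -> exists y, forall s, s \in S -> on_curve x (y + s)) ->
  (#|Z| <= (D + 6) * r)%N.
Proof.
move=> qS HZ; have [c [ct Hc]] := exists_annihilating_coeffs.
pose h := \sum_t (c t)%:P *: reduce q g (term t).
have h0 : h != 0.
  apply: contraTneq (sum_distinct_degrees_neq0
    (P := fun t => weight_poly q (reduce q g (term t)))
    (w := fun t : T => (t.2.1 * q + t.2.2 + r * (q * t.1.1 + t.1.2) + (q + r * q))%N) _ _ ct).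
  - move=> h0; rewrite negbK; apply/eqP.
    have : weight_poly q h = 0 by rewrite h0 /weight_poly rmorph0 horner0.
    rewrite weight_poly_sum => E; rewrite -[RHS]E; apply: eq_bigr => t _.
    by rewrite weight_polyZ comp_polyC mul_polyC.
  - move=> [[i j] [k l]] [[i' j'] [k' l']] /= /addIn E.
    (* The weight is read in base [r], with lower digit [k q + l] and upper part [q i + j]; both are
       then read in base [q]. *)
    have kl (k0 : 'I_D) (l0 : 'I_q) : (k0 * q + l0 < r)%N.
      by have := ltn_ord k0; have := ltn_ord l0; rewrite /r; nia.
    have [E1 E2] := add_muln_inj (kl k l) (kl k' l') E.
    rewrite addnC [in RHS]addnC mulnC [(k' * q)%N]mulnC in E1.
    rewrite addnC [in RHS]addnC in E2.
    have [/val_inj-> /val_inj->] := add_muln_inj (ltn_ord _) (ltn_ord _) E1.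
    by have [/val_inj-> /val_inj->] := add_muln_inj (ltn_ord _) (ltn_ord _) E2.
  - move=> t; rewrite size_weight_curve_term ?ltn_ord //; congr _.+1; rewrite /r; nia.
have szh : (size h <= q)%N.
  apply: (leq_trans (size_sum _ _ _)); apply/bigmax_leqP => t _.
  apply: (leq_trans (size_scale_leq _ _)); apply: size_reduce; first by lia.
  exact: size_curve_term.
have xh : xdeg ((D + 5) * r + 1) h.
  apply: xdeg_sum => t _; rewrite -[((D + 5) * r + 1)%N]add0n; apply: xdegZ.
    by rewrite size_polyC; case: (c t != 0).
  have xt : xdeg (t.2.1 + t.1.1 * r + r.*2 - D) (term t) by exact: xdeg_curve_term.
  apply: xdeg_leq (xdeg_reduce q szg xt).
  by have := ltn_ord t.2.1; have := ltn_ord t.1.1; rewrite /r; nia.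
have h_curve x y : on_curve x y -> eval2 x y h = 0.
  move=> [x0 xy Axy].
  have eval_red e j l : (l < q)%N -> eval2 x y (reduce q g (curve_term q D A e j l)) =
      x ^+ r.+1 * (x ^+ e * y ^+ (j + r * l)).
    move=> lq; rewrite eval2_reduce // (eval2_curve_term _ _ (ltnW lq) Axy).
    by rewrite mulrA -exprS [(e + _)%N]addnC -addSn exprD -mulrA.
  have eval_sum (cc : T -> L) (u : T -> {poly {poly L}}) :
      eval2 x y (\sum_t (cc t)%:P *: u t) = \sum_t cc t * eval2 x y (u t).
    rewrite /eval2 !horner_sum; apply: eq_bigr => t _.
    by rewrite hornerZ hornerM hornerC.
  have : eval2 x y (\sum_t (c t ^+ r)%:P *: reduce q g (dual_term t)) = 0.
    by rewrite Hc /eval2 !horner0.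
  rewrite !eval_sum => E1.
  have E2 : \sum_t c t * (x ^+ (t.2.1 + t.1.1 * r) * y ^+ (t.2.2 + r * t.1.2)) = 0.
    suff /eqP : (\sum_t c t * (x ^+ (t.2.1 + t.1.1 * r) * y ^+ (t.2.2 + r * t.1.2))) ^+ r = 0.
      by rewrite expf_eq0 => /andP[_ /eqP].
    rewrite expr_sum_pchar //.
    (* The common factor [x^(r + 1)] comes from clearing denominators and from the reduction; it
       cancels as [x] is nonzero on the curve. *)
    have : x ^+ r.+1 != 0 by rewrite expf_neq0.
    move/mulfI => inj; apply: inj; rewrite mulr0 -[RHS]E1 mulr_sumr.
    apply: eq_bigr => t _; rewrite eval_red // !exprMn [LHS]mulrCA.
    congr (_ * (_ * (_ * _))).
      by rewrite !exprD exprMn [(x ^+ (_ * r))]exprM expr_r2 -exprM.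
    by rewrite !exprD exprMn mulnC [(y ^+ (_ * r))]exprM expr_r2 -exprM mulrC mulnC.
  transitivity (x ^+ r.+1 * (\sum_t c t *
      (x ^+ (t.2.1 + t.1.1 * r) * y ^+ (t.2.2 + r * t.1.2)))).
    by rewrite mulr_sumr; apply: eq_bigr => t _; rewrite eval_red // mulrCA.
  by rewrite E2 mulr0.
have lh : lead_coef h != 0 by rewrite lead_coef_eq0.
have := card_roots_leq (Z := Z) lh; move/(_ _)/leq_trans => HH.
apply: (@leq_trans ((D + 5) * r + 1)); last by nia.
rewrite -ltnS; apply: HH (xh _) => x /HZ [y Hy].
(* [h] has degree [< q] in [y] but vanishes at [q] points above [x], so all its
   coefficients vanish at [x]. *)
pose hx := map_poly (horner_eval x) h.
suff hx0 : hx = 0.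
  have : hx`_((size h).-1) = 0 by rewrite hx0 coef0.
  by rewrite coef_map.
apply/eqP/negPn/negP => hx0.
have := @card_roots_leq _ hx [set y + s | s in S] hx0.
rewrite card_imset; last by move=> s s' /addrI.
move/(_ _)/leq_trans => HS; suff : (q < q)%N by rewrite ltnn.
apply: leq_ltn_trans qS _; apply: HS.
  move=> _ /imsetP[s sS ->]; rewrite -[y + s](hornerC _ x) -[_.[x]]/(horner_eval x _).
  by rewrite /hx horner_map; apply: h_curve; exact: Hy.
by apply: leq_trans szh; rewrite size_poly.
Qed.
End StepanovCore.

Lemma card_leq_fibers (T U : finType) (A : {set T}) (B : {set U}) (f : T -> U) k :
    (forall x, x \in A -> f x \in B) ->
    (forall u, u \in B -> (#|[set x in A | f x == u]| <= k)%N) ->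
  (#|A| <= k * #|B|)%N.
Proof.
move=> fB fib; rewrite -sum1_card (partition_big f (mem B)) //=.
rewrite mulnC -sum_nat_const; apply: leq_sum => u uB.
by apply: leq_trans (fib u uB); rewrite -sum1_card; under [X in (_ <= X)%N]eq_bigl do rewrite inE.
Qed.

Lemma pchar_nat_card (K : finFieldType) : [pchar K].-nat #|K|.
Proof.
have [p pr_p pK] := finPcharP K.
by rewrite (card_pprimeChar pK) pnatX pnatE // pK.
Qed.

(** * Points on Artin-Schreier curves and elements of trace zero *)

Section ArtinSchreier.

Variables (F L : finFieldType) (iota : {rmorphism F -> L}) (m : nat).
Let q := #|F|.
Let D := (q ^ m)%N.
Let r := (q * D)%N.
Hypothesis q_gt2 : (2 < q)%N.
Hypothesis cardL : #|L| = (r ^ 2)%N.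
Variables (a b : L).
Hypothesis a0 : a != 0.

Let D_gt0 : (0 < D)%N. Proof. by rewrite expn_gt0 (ltnW (ltnW q_gt2)). Qed.
Let r_gt2 : (2 < r)%N. Proof. by rewrite /r; move: q_gt2 D_gt0; nia. Qed.
Let qnat : [pchar L].-nat q.
Proof. by apply: pnat_dvd (pchar_nat_card L); rewrite cardL /r expnMn dvdn_mulr // dvdn_exp. Qed.
Let rnat : [pchar L].-nat r.
Proof. by rewrite pnatM qnat pnatX qnat. Qed.

(** On the curve [y^q - y = g/x], and adding the powers of exponents [q^i] for [i <= m] telescopes
    to [y^r - y]. Thus [A c] is [x^D (y^r - y)] there, with denominators cleared. *)
Let g (c : L) : {poly L} := a *: 'X^2 - c *: 'X + b%:P.
Let A (c : L) : {poly L} := \sum_(i < m.+1) 'X^(D - q ^ i) * g c ^+ (q ^ i).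

Let szg c : size (g c) = 3.
Proof.
rewrite /g -addrA size_polyDl size_scale ?size_polyXn //.
apply: (leq_ltn_trans (size_polyD _ _)); rewrite gtn_max; apply/andP; split.
  by rewrite size_polyN (leq_ltn_trans (size_scale_leq _ _)) // size_polyX.
by rewrite size_polyC; case: (b != 0).
Qed.

Let szA c : size (A c) = (D.*2).+1.
Proof.
have sz i : (q ^ i <= D)%N -> size ('X^(D - q ^ i) * g c ^+ (q ^ i)) = (D + q ^ i).+1.
  move=> iD; have g0 : g c ^+ (q ^ i) != 0 by rewrite expf_neq0 // -size_poly_eq0 szg.
  have sg : size (g c ^+ (q ^ i)) = (2 * q ^ i).+1.
    by rewrite -[LHS]prednK ?size_poly_gt0 // size_exp szg.
  by rewrite mulrC size_mulXn // sg; lia.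
rewrite /A big_ord_recr /= addrC size_polyDl sz -?/D ?addnn //.
rewrite ltnS; apply: (leq_trans (size_sum _ _ _)); apply/bigmax_leqP => i _.
have im : (q ^ i < D)%N by rewrite ltn_exp2l // ltnW.
by rewrite sz; lia.
Qed.

Definition artin_schreier_set (c : L) : {set L} :=
  [set x | (x != 0) && [exists y, y ^+ q - y == a * x + b / x - c]].

Let on_curve_point c (x y : L) : x != 0 -> y ^+ q - y = a * x + b / x - c ->
  on_curve q D (g c) (A c) x y.
Proof.
move=> x0 Hy; have gx : (g c).[x] = x * (y ^+ q - y).
  by rewrite Hy /g hornerD hornerD hornerN !hornerZ hornerXn hornerX hornerC; field.
split=> //; first by rewrite gx mulrBr addrC subrK.
have yi i : y ^+ (q ^ i) ^+ q = y ^+ (q ^ i.+1) by rewrite -exprM -expnSr.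
have term i : (q ^ i <= D)%N -> x ^+ (D - q ^ i) * (g c).[x] ^+ (q ^ i) =
    x ^+ D * (y ^+ (q ^ i.+1) - y ^+ (q ^ i)).
  move=> iD; rewrite gx exprMn mulrA -exprD subnK //; congr (_ * _).
  have qi : [pchar L].-nat (q ^ i)%N by rewrite pnatX qnat.
  apply/eqP; rewrite eq_sym subr_eq -exprDn_pchar // subrK.
  by rewrite expnS exprM.
rewrite /A horner_sum (eq_bigr (fun i : 'I__ =>
    x ^+ D * (y ^+ (q ^ i.+1) - y ^+ (q ^ i)))) => [|i _]; last first.
  by rewrite hornerM hornerXn horner_exp term // leq_exp2l ?(ltnW q_gt2) // -ltnS.
rewrite -mulr_sumr; congr (_ * _).
rewrite -(big_mkord xpredT (fun i => y ^+ (q ^ i.+1) - y ^+ (q ^ i))) telescope_sumr //.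
by rewrite expn0 expr1 expnS.
Qed.

(** The points above a given [x] form a coset of [F], so each fibre has the [q] points required by
    [stepanov_core]. As [D r = r^2 / q], the curve has at most [r^2 + 6 q r] points with [x]
    nonzero. *)
Lemma artin_schreier_set_card c : (#|artin_schreier_set c| <= (D + 6) * r)%N.
Proof.
apply: (@stepanov_core L q D (g c) (A c) _ _ _ _ _ _ _ (iota @: [set: F])) => //.
- exact: ltnW.
- by rewrite szg.
- by rewrite card_imset ?cardsT //; exact: fmorph_inj.
move=> x; rewrite inE => /andP[x0 /existsP[y /eqP Hy]].
exists y => _ /imsetP[s _ ->]; apply: on_curve_point => //.
by rewrite exprDn_pchar // -rmorphXn expf_card opprD addrACA subrr addr0.
Qed.

Let W : {set L} := [set y ^+ q - y | y in L].

Let cardW : (#|L| <= q * #|W|)%N.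
Proof.
rewrite -cardsT; apply: (@card_leq_fibers _ _ _ _ (fun y => y ^+ q - y)).
  by move=> y _; apply: imset_f.
move=> w _; rewrite -ltnS.
have sz : size ('X^q - 'X - w%:P : {poly L}) = q.+1.
  rewrite -addrA size_polyDl size_polyXn //.
  apply: (leq_ltn_trans (size_polyD _ _)); rewrite gtn_max !size_polyN size_polyX.
  rewrite size_polyC; case: (w != 0); lia.
rewrite -sz; apply: card_roots_leq; first by rewrite -size_poly_eq0 sz.
by move=> y; rewrite !inE /= => /eqP <-; rewrite !hornerE ?hornerXn subrr.
Qed.

Lemma in_artin_schreier_set c x :
  (x \in artin_schreier_set c) = (x != 0) && (a * x + b / x - c \in W).
Proof.
rewrite inE; congr (_ && _); apply/existsP/imsetP => [[y /eqP <-]|[y _ ->]].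
  by exists y.
by exists y.
Qed.

(** An upper bound for every [c] becomes a lower bound on average: the sets for all [c] have total
    size [(#|L| - 1) #|W|], those with [c] outside [W] take at most their Stepanov bound, and those
    with [c] in [W] lie inside [N0], because [tau] vanishes on [W]. *)
Lemma trace_zero_card_lb (tau : L -> F) :
    {morph tau : x y / x + y} -> (forall x, tau (x ^+ q) = tau x) ->
  (#|L| <= q * #|[set x : L | (x != 0)%R && (tau (a * x + b / x) == 0)%R]| + 7 * q ^ 2 * r)%N.
Proof.
move=> tauD tauq; set N0 := [set x | _ ].
have W_tau w : w \in W -> tau w = 0.
  move=> /imsetP[y _ ->]; apply: (@addIr _ (tau y)).
  by rewrite add0r -tauD subrK tauq.
have WD w w' : w \in W -> w' \in W -> w + w' \in W.
  move=> /imsetP[y _ ->] /imsetP[y' _ ->]; apply/imsetP; exists (y + y') => //.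
  by rewrite exprDn_pchar // opprD addrACA.
have sub0 c : c \in W -> (#|artin_schreier_set c| <= #|N0|)%N.
  move=> cW; apply: subset_leq_card; apply/subsetP => x; rewrite in_artin_schreier_set.
  move=> /andP[x0 xW]; rewrite inE x0 /=; apply/eqP/W_tau.
  by rewrite -[a * x + b / x](subrK c) WD.
have sumN : (\sum_(c : L) #|artin_schreier_set c| = (#|L|.-1) * #|W|)%N.
  under eq_bigr do rewrite -sum1_card big_mkcond /=.
  rewrite exchange_big /= (bigD1 0) //= [X in (X + _)%N]big1 ?add0n; last first.
    by move=> c _; rewrite in_artin_schreier_set eqxx.
  rewrite (eq_bigr (fun _ => #|W|)) => [|x x0]; last first.
    rewrite -big_mkcond /= sum1_card.
    rewrite -(card_imset (mem W) (inj_comp (addrI (a * x + b / x)) oppr_inj)).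
    apply: eq_card => c; rewrite -[LHS]/(x \in artin_schreier_set c) in_artin_schreier_set x0 /=.
    apply/idP/imsetP => [cW|[w wW ->]] /=.
      by exists (a * x + b / x - c) => //=; rewrite opprB addrC subrK.
    by rewrite opprB addrC subrK.
  by rewrite sum_nat_const; congr (_ * _)%N; rewrite cardC1.
(* At most [(q - 1) #|W|] values of [c] lie outside [W], so the factor [#|W|] can be cancelled. This
   leaves [D r <= #|N0| + 6 (q - 1) r + 1]. *)
have leN : ((#|L|.-1) * #|W| <= #|W| * #|N0| + (#|L| - #|W|) * ((D + 6) * r))%N.
  rewrite -sumN (bigID (mem W)) /= leq_add //.
    by rewrite -sum_nat_const leq_sum.
  rewrite -(cardsC W) addKn -sum_nat_const.
  under [X in (_ <= X)%N]eq_bigl do rewrite inE.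
  by apply: leq_sum => c _; apply: artin_schreier_set_card.
have LqDr : #|L| = (q * (D * r))%N by rewrite cardL -mulnn {1}/r mulnA.
have W0 : (0 < #|W|)%N by apply/card_gt0P; exists (1 ^+ q - 1); apply: imset_f.
have DX : ((D + 6) * r = D * r + 6 * r)%N by rewrite mulnDl.
move: leN cardW; rewrite LqDr DX leq_pmul2l; last by lia.
move: (D * r)%N => X leN XW.
have q_gt0 : (0 < q)%N by lia.
have le1 : (q * X - #|W| <= (q - 1) * #|W|)%N.
  by rewrite leq_subLR -mulSn -subSn // subn1 leq_pmul2l.
have le2 : ((q * X).-1 * #|W| <= (#|N0| + (q - 1) * (X + 6 * r)) * #|W|)%N.
  apply: (leq_trans leN); rewrite mulnDl mulnC leq_add2l mulnAC leq_mul2r le1.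
  by rewrite orbT.
move: le2; rewrite leq_pmul2r // => le2.
have -> : (7 * q ^ 2 * r = q * (7 * (q * r)))%N by rewrite -mulnn; lia.
rewrite -mulnDr leq_pmul2l //.
have [k qk] : exists k, q = k.+1 by exists q.-1; lia.
have r_gt0 : (0 < r)%N by lia.
move: le2; rewrite qk subn1 /= mulnDr mulSn => le2; move: r_gt0 le2.
by move: r (#|N0|) => r' n; clear; nia.
Qed.

End ArtinSchreier.

(** * Kloosterman sums *)

Lemma sum_fibers (T U : finType) (R : nzRingType) (P : pred U) (f : T -> U) (G : U -> R) :
  \sum_(x | P (f x)) G (f x) = \sum_(u | P u) #|[set x | f x == u]|%:R * G u.
Proof.
rewrite (partition_big f P) //=; apply: eq_bigr => u Pu.
rewrite (eq_bigr (fun _ => G u)) => [|x /andP[_ /eqP->]//].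
rewrite sumr_const mulr_natl; congr (_ *+ _); rewrite -sum1dep_card -sum1_card.
apply: eq_bigl => x; rewrite unfold_in /=.
by case: eqP => [->|]; rewrite ?Pu ?andbF.
Qed.

Record add_char (F : finFieldType) (psi : F -> algC) : Prop := AddChar {
  add_char0 : psi 0 = 1;
  add_charD : forall x y, psi (x + y) = psi x * psi y;
  add_char_nontrivial : exists x, psi x != 1 }.

Lemma card_natr0 (F : finFieldType) : #|F|%:R = 0 :> F.
Proof.
have [p pr_p pF] := finPcharP F.
have cF := card_pprimeChar pF; move: (logn _ _) cF => n cF.
have := finNzRing_gt1 F; rewrite cF; case: n {cF} => [|n] // _.
by rewrite natrX (pcharf0 pF) exprS mul0r.
Qed.

Section AddChar.

Variables (F : finFieldType) (psi : F -> algC).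
Hypothesis psiC : add_char psi.

Lemma add_charMn x n : psi (x *+ n) = psi x ^+ n.
Proof.
elim: n => [|n IH]; first by rewrite mulr0n expr0 add_char0.
by rewrite mulrS exprS add_charD // IH.
Qed.

Lemma add_char_norm x : `|psi x| = 1.
Proof.
have : `|psi x| ^+ #|F| = 1.
  rewrite -normrX -add_charMn -mulr_natr card_natr0 mulr0 add_char0 //.
  exact: normr1.
move/eqP; rewrite pexpr_eq1 ?normr_ge0 //; first by move/eqP.
by rewrite (ltn_trans _ (finNzRing_gt1 F)).
Qed.

Lemma add_charVN x : psi x * psi (- x) = 1.
Proof. by rewrite -add_charD // subrr add_char0. Qed.

Lemma add_char_conj x : (psi x)^* = psi (- x).
Proof.
have psi0 : psi x != 0 by rewrite -normr_eq0 add_char_norm oner_eq0.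
apply: (mulfI psi0); rewrite add_charVN -normCK add_char_norm; exact: expr1n.
Qed.

Lemma add_char_sum : \sum_x psi x = 0.
Proof.
have [y psiy] := add_char_nontrivial psiC; apply: (mulfI (x := psi y - 1)).
  by rewrite subr_eq0.
rewrite mulr0 mulrBl mul1r mulr_sumr [X in _ - X](reindex_inj (addrI y)) /=.
by under [X in _ - X]eq_bigr do rewrite add_charD //; rewrite subrr.
Qed.

Lemma add_char_sumM c : \sum_x psi (c * x) = (c == 0)%:R * #|F|%:R.
Proof.
have [->|c0] := eqVneq c 0.
  rewrite mul1r (eq_bigr (fun _ => 1)) => [|x _]; last by rewrite mul0r add_char0.
  by rewrite sumr_const.
by rewrite mul0r -[RHS]add_char_sum [RHS](reindex_inj (mulfI c0)).
Qed.

Definition kloosterman (a b : F) : algC := \sum_(x | x != 0) psi (a * x + b / x).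

Lemma kloosterman_real a b : kloosterman a b \is Num.real.
Proof.
apply/CrealP; rewrite /kloosterman rmorph_sum /= (reindex_inj oppr_inj) /=.
under eq_bigl do rewrite oppr_eq0.
by apply: eq_bigr => x _; rewrite add_char_conj invrN !mulrN -opprD opprK.
Qed.

End AddChar.

(** A coordinate functional over the prime field is composed with the powers of a primitive [p]-th
    root of unity. Choosing a coordinate that is nonzero at 1 makes the character nontrivial. *)
Lemma add_char_exists (F : finFieldType) : exists psi : F -> algC, add_char psi.
Proof.
have [p pr_p pF] := finPcharP F.
have [z zp] := C_prim_root_exists (prime_gt0 pr_p).
pose V : vectType 'F_p := pPrimeCharType pF.
have V1 : (1 : F) != 0 := oner_neq0 F.
pose X := vbasis {:V}.
have [i Xi] : exists i, coord X i (1 : F) != 0.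
  apply/existsP; apply: contraR V1; rewrite negb_exists => /forallP c0.
  rewrite (coord_vbasis (memvf (1 : V))) big1 // => i _.
  by have := c0 i; rewrite negbK => /eqP ->; rewrite scale0r.
exists (fun x : F => z ^+ (coord X i (x : V) : 'F_p)); split.
- by rewrite linear0 expr0.
- move=> x y; rewrite (linearD (coord X i)) -exprD; apply/eqP.
  rewrite (eq_prim_root_expr zp).
  have addE (u v : 'F_p) : ((u + v)%R : nat) = ((u + v) %% p)%N.
    exact: (congr1 (modn (u + v)) (Fp_cast pr_p)).
  by rewrite addE modn_mod.
exists 1; rewrite -(prim_order_dvd zp); apply: contra Xi => pd.
have cp : (coord X i (1 : V) < p)%N.
  exact: leq_trans (ltn_ord _) (eq_leq (Fp_cast pr_p)).
by apply/eqP/val_inj => /=; move: pd cp; case: (nat_of_ord _) => // n /dvdn_leq; lia.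
Qed.

(** Squaring identifies 1 and -1, so it is not injective, hence not surjective. *)
Lemma nonsquare_exists (K : finFieldType) : 2 != 0 :> K ->
  exists e : K, forall x, x ^+ 2 != e.
Proof.
move=> K2; pose S := [set x ^+ 2 | x : K].
have [e eS | full] := pickP [pred e | e \notin S].
  by exists e => x; apply: contraNneq eS => <-; apply: imset_f.
have /imset_injP inj : #|S| == #|[pred x : K | true]|.
  by apply/eqP/eq_card => e; have /negbFE := full e; rewrite !inE.
have /eqP := inj 1 (- 1) isT isT (esym (sqrrN 1)).
by rewrite -subr_eq0 opprK -mulr2n (negPf K2).
Qed.

Lemma quadratic_extension_exists (K : finFieldType) : 2 != 0 :> K ->
  exists (L : finFieldType) (iota : {rmorphism K -> L}), #|L| = (#|K| ^ 2)%N.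
Proof.
move=> /nonsquare_exists[e He].
have sz : size ('X^2 - e%:P : {poly K}) = 3 by rewrite size_XnsubC.
have irr : irreducible_poly ('X^2 - e%:P : {poly K}).
  apply: cubic_irreducible; first by rewrite sz.
  by move=> x; rewrite rootE !hornerE ?hornerXn subr_eq0.
have [L0 dimL _] := irredp_FAdjoin irr.
pose L := FinFieldExtType L0.
have iota : {rmorphism K -> L} := (in_alg L0 : {rmorphism K -> L0}).
exists L, iota.
have := card_vspacef (Vector.class (finvect_type L0 : vectType K)).
rewrite card_vspace => <-; congr (_ ^ _)%N.
by move: dimL; rewrite sz.
Qed.

(** * Trace, norm and Kloosterman sums in a quadratic extension *)

Section QuadraticExtension.

Variables (K L : finFieldType) (iota : {rmorphism K -> L}).
Let Q := #|K|.
Hypothesis cardL : #|L| = (Q ^ 2)%N.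

Let Qnat : [pchar L].-nat Q.
Proof. by apply: pnat_dvd (pchar_nat_card L); rewrite cardL dvdn_exp. Qed.

Lemma frobenius_fixed (v : L) : v ^+ Q = v -> exists u, iota u = v.
Proof.
move=> Hv; have : (map_poly iota ('X^#|K| - 'X)).[v] = 0.
  by rewrite rmorphB /= map_polyXn map_polyX !hornerE ?hornerXn Hv subrr.
rewrite finField_genPoly rmorph_prod /= horner_prod => /eqP.
rewrite prodf_seq_eq0 => /hasP[u _ /andP[_]]; rewrite rmorphB /= map_polyX map_polyC /=.
by rewrite !hornerE subr_eq0 => /eqP->; exists u.
Qed.

Let frobK (x : L) : (x ^+ Q) ^+ Q = x.
Proof. by rewrite -exprM mulnn -cardL expf_card. Qed.

Let frobD (x y : L) : (x + y) ^+ Q = x ^+ Q + y ^+ Q.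
Proof. exact: exprDn_pchar. Qed.

Let frob_iota u : iota u ^+ Q = iota u.
Proof. by rewrite -rmorphXn expf_card. Qed.

(** Trace and norm are taken with values in [K] itself, as preimages under [iota]. The default 0 is
    never reached, since both expressions are fixed by Frobenius. *)
Definition qtrace (x : L) : K := odflt 0 [pick u | iota u == x + x ^+ #|K|].
Definition qnorm (x : L) : K := odflt 0 [pick u | iota u == x * x ^+ #|K|].

Lemma iota_qtrace x : iota (qtrace x) = x + x ^+ Q.
Proof.
rewrite /qtrace; case: pickP => [u /eqP//|none].
have [|u Hu] := @frobenius_fixed (x + x ^+ Q); first by rewrite frobD frobK addrC.
by have := none u; rewrite Hu eqxx.
Qed.

Lemma iota_qnorm x : iota (qnorm x) = x * x ^+ Q.
Proof.
rewrite /qnorm; case: pickP => [u /eqP//|none].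
have [|u Hu] := @frobenius_fixed (x * x ^+ Q); first by rewrite exprMn frobK mulrC.
by have := none u; rewrite Hu eqxx.
Qed.

Let iota_inj : injective iota := fmorph_inj iota.

Lemma qtraceD x y : qtrace (x + y) = qtrace x + qtrace y.
Proof. by apply: iota_inj; rewrite rmorphD !iota_qtrace frobD addrACA. Qed.

Lemma qtraceZ u x : qtrace (iota u * x) = u * qtrace x.
Proof. by apply: iota_inj; rewrite rmorphM !iota_qtrace exprMn frob_iota mulrDr. Qed.

Lemma qtrace_iota u : qtrace (iota u) = 2 * u.
Proof. by apply: iota_inj; rewrite iota_qtrace frob_iota mulr_natl rmorphMn mulr2n. Qed.

Lemma qnorm_eq0 x : (qnorm x == 0) = (x == 0).
Proof.
rewrite -(fmorph_eq0 iota) iota_qnorm mulf_eq0 expf_eq0.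
by case: (x == 0); rewrite ?andbF.
Qed.

Lemma qtraceV x : x != 0 -> qtrace x^-1 = qtrace x / qnorm x.
Proof.
move=> x0; apply: iota_inj.
have xQ0 : x ^+ Q != 0 by rewrite expf_neq0.
rewrite fmorph_div !iota_qtrace iota_qnorm exprVn; field; exact/andP.
Qed.

(* Each sum is at most 2, and the sums add up to #|L| + #|K * K| = 2 * #|K * K|. *)
Lemma card_trace_norm_fibers (t n : K) :
  (#|[set x : L | (qtrace x, qnorm x) == (t, n)]| +
   #|[set z : K * K | ((z.1 + z.2)%R, (z.1 * z.2)%R) == (t, n)]| = 2)%N.
Proof.
pose NL (u : K * K) := #|[set x : L | (qtrace x, qnorm x) == u]|.
pose NK (u : K * K) := #|[set z : K * K | ((z.1 + z.2)%R, (z.1 * z.2)%R) == u]|.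
rewrite -/(NL (t, n)) -/(NK (t, n)).
have sub2 (T : finType) (A : {set T}) (x y : T) : A \subset [set x; y] -> (#|A| <= 2)%N.
  by move/subset_leq_card/leq_trans; apply; rewrite cards2; case: (x != y).
have le2 u : (NL u + NK u <= 2)%N.
  case: u => {}t {}n; rewrite /NL /NK.
  set A := [set x | _ ]; set B := [set z | _].
  have Aeq x : x \in A -> [/\ x ^+ 2 - iota t * x + iota n = 0 & x + x ^+ Q = iota t].
    rewrite inE => /eqP[<- <-]; rewrite iota_qtrace iota_qnorm; split=> //; ring.
  (* If [X^2 - t X + n] has no root in [K], no pair over [K] counts. Given a root [u], the pairs are
     [(u, t - u)] and [(t - u, u)], while an element of [L] that counts lies in [K], so it equals
     its conjugate and the root is double. *)
  have [u Hu | noroot] := pickP [pred u | u ^+ 2 - t * u + n == 0]; last first.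
    have -> : B = set0.
      apply/setP => -[x y]; rewrite !inE /=; apply/negP => /eqP[xy1 xy2].
      by have /negP := noroot x; apply; apply/eqP; rewrite -xy1 -xy2 /=; ring.
    rewrite cards0 addn0.
    have sz : size ('X^2 - iota t *: 'X + (iota n)%:P : {poly L}) = 3.
      rewrite -addrA size_polyDl size_polyXn // (leq_ltn_trans (size_polyD _ _)) //.
      rewrite gtn_max size_polyN (leq_ltn_trans (size_scale_leq _ _)) ?size_polyX //=.
      by rewrite size_polyC; case: (_ != _).
    have p0 : ('X^2 - iota t *: 'X + (iota n)%:P : {poly L}) != 0 by rewrite -size_poly_eq0 sz.
    suff: (#|A| < size ('X^2 - iota t *: 'X + (iota n)%:P : {poly L})%R)%N by rewrite sz.
    apply: card_roots_leq => //.
    by move=> x /Aeq[Hx _]; rewrite hornerD hornerD hornerN hornerZ hornerXn hornerX hornerC.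
  have Hn : n = u * (t - u).
    by apply/eqP; rewrite -subr_eq0 -(eqP Hu); apply/eqP; ring.
  have BS : B \subset [set (u, t - u); (t - u, u)].
    apply/subsetP => -[x y]; rewrite !inE /= => /eqP[xy1 xy2].
    have : (x - u) * (x - (t - u)) = 0.
      transitivity (x ^+ 2 - t * x + u * (t - u)); first by ring.
      by rewrite -Hn -xy1 -xy2; ring.
    have -> : y = t - x by rewrite -xy1 addrC addKr.
    move/eqP; rewrite mulf_eq0 !subr_eq0 => /orP[]/eqP ->; first by rewrite eqxx.
    by rewrite subKr eqxx orbT.
  have Ax x : x \in A -> x = iota u /\ t - u = u.
    move=> /Aeq[Hx1 Hx2]; have : (x - iota u) * (x - iota (t - u)) = 0.
      by rewrite -[RHS]Hx1 Hn rmorphM rmorphB; ring.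
    move/eqP; rewrite mulf_eq0 !subr_eq0 => /orP[]/eqP xE; move: Hx2.
      rewrite xE frob_iota -rmorphD => /iota_inj <-; split=> //; by rewrite addrK.
    rewrite xE frob_iota -rmorphD => /iota_inj E.
    have E2 : t - u = u by apply: (addrI (t - u)); rewrite E subrK.
    by rewrite E2.
  have [tu | tu] := eqVneq (t - u) u.
    rewrite -[2%N]/(1 + 1)%N leq_add //.
      rewrite -(cards1 (iota u)); apply: subset_leq_card; apply/subsetP => x /Ax[-> _].
      by rewrite inE.
    apply: leq_trans (subset_leq_card BS) _; by rewrite tu setUid cards1.
  have -> : A = set0.
    by apply/setP => x; rewrite [RHS]inE; apply/negP => /Ax[_ /eqP]; rewrite (negPf tu).
  by rewrite cards0; exact: sub2 BS.
have /leqif_sum [_ Hsum] : forall u : K * K, xpredT u ->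
    (NL u + NK u <= 2 ?= iff (NL u + NK u == 2))%N.
  by move=> u _; split.
move: Hsum; rewrite big_split /= sum_nat_const.
have sumfib (T : finType) (f : T -> K * K) : (\sum_u #|[set x | f x == u]| = #|T|)%N.
  rewrite -sum1_card (partition_big f xpredT) //=; apply: eq_bigr => u _.
  by rewrite -sum1_card; apply: eq_bigl => x; rewrite inE.
rewrite !sumfib card_prod cardL -/Q mulnn muln2 -addnn eqxx => /esym/forallP/(_ (t, n)).
by move/eqP.
Qed.

Lemma kloosterman_quadratic (chi : K -> algC) (a b : K) : add_char chi ->
    a != 0 -> b != 0 ->
  kloosterman (chi \o qtrace) (iota a) (iota b) = 2 * Q%:R - kloosterman chi a b ^+ 2.
Proof.
move=> chiC a0 b0; apply/eqP; rewrite eq_sym subr_eq eq_sym; apply/eqP.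
(* Both sums depend on trace and norm, or sum and product, only: [1/x] has trace [t/n], and
   [1/z1 + 1/z2] is [t/n] as well. *)
pose G (u : K * K) := chi ((a + b / u.2) * u.1).
pose P (u : K * K) := u.2 != 0.
have -> : kloosterman (chi \o qtrace) (iota a) (iota b) =
    \sum_(u | P u) #|[set x | (qtrace x, qnorm x) == u]|%:R * G u.
  rewrite -sum_fibers; apply: eq_big => x; first by rewrite /P /= qnorm_eq0.
  by move=> x0; rewrite /G /= qtraceD !qtraceZ qtraceV // mulrDl mulrA mulrAC.
have -> : kloosterman chi a b ^+ 2 =
    \sum_(u | P u) #|[set z : K * K | (z.1 + z.2, z.1 * z.2) == u]|%:R * G u.
  rewrite -(sum_fibers P (fun z : K * K => (z.1 + z.2, z.1 * z.2))).
  rewrite expr2 /kloosterman mulr_suml; under eq_bigr do rewrite mulr_sumr.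
  rewrite pair_big /=; apply: eq_big => [z|z /andP[z1 z2]].
    by rewrite /P /= mulf_eq0 negb_or.
  rewrite -add_charD // /G /=; congr chi; field; exact/andP.
rewrite -big_split /= (eq_bigr (fun u => 2 * G u)) => [|[t n] _]; last first.
  by rewrite -mulrDl -natrD card_trace_norm_fibers.
rewrite -mulr_sumr; congr (_ * _).
rewrite (eq_bigl (fun u : K * K => xpredT u.1 && (u.2 != 0))) //.
rewrite -(pair_big xpredT (fun n : K => n != 0) (fun t n => G (t, n))) exchange_big /=.
under eq_bigr do rewrite /G /= add_char_sumM //.
(* This is the only [n] with [a + b / n = 0], hence the only one that survives the sum over [t]. *)
have n0 : - b / a != 0 by rewrite mulf_neq0 ?oppr_eq0 ?invr_eq0.
rewrite (bigD1 (- b / a)) //= big1 ?addr0 => [|n /andP[n1 nba]].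
  rewrite (_ : a + b / (- b / a) = 0) ?eqxx ?mul1r //; field.
  by rewrite oppr_eq0 a0 b0.
rewrite (_ : (_ == 0) = false) ?mul0r //; apply: contraNF nba => /eqP E.
apply/eqP; have : (a + b / n) * n / a = 0 by rewrite E !mul0r.
move=> E2; rewrite -[RHS]addr0 -E2; field; exact/andP.
Qed.

End QuadraticExtension.

(** The Kloosterman sum over the extension of degree [2^j], expressed through the sum [k] over the
    ground field of size [q]. *)
Fixpoint kloosterman_iter (q : nat) (k : algC) (j : nat) : algC :=
  if j is i.+1 then 2 * (q ^ (2 ^ i))%:R - kloosterman_iter q k i ^+ 2 else k.

(** * The bound for Kloosterman sums by climbing a tower of quadratic extensions *)

Section Weil.

Variables (F : finFieldType) (psi : F -> algC).
Hypothesis psiC : add_char psi.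
Hypothesis F2 : 2 != 0 :> F.
Let q := #|F|.

(** Here [tau] is the composite of the successive traces. Its linearity over [F] and its invariance
    under the Frobenius of [F] are kept for the count of elements of trace zero. *)
Lemma kloosterman_tower j :
  exists (L : finFieldType) (iota : {rmorphism F -> L}) (tau : L -> F),
    [/\ #|L| = (q ^ (2 ^ j))%N,
        {morph tau : x y / x + y},
        (forall s x, tau (iota s * x) = s * tau x),
        (forall x, tau (x ^+ q) = tau x) &
        add_char (psi \o tau) /\ forall a b : F, a != 0 -> b != 0 ->
          kloosterman (psi \o tau) (iota a) (iota b) =
          kloosterman_iter q (kloosterman psi a b) j].
Proof.
elim: j => [|j [K [iota [tau [cK tauD tauZ tauq [tauC tauK]]]]]].
  exists F, (idfun : {rmorphism F -> F}), id; split=> //.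
  exact: expf_card.
have K2 : 2 != 0 :> K by rewrite -(rmorph_nat iota) fmorph_eq0.
have [L [kappa cL]] := quadratic_extension_exists K2.
have tr_iota x : qtrace kappa (kappa x) = 2 * x by exact: qtrace_iota.
exists L, (kappa \o iota : {rmorphism F -> L}), (tau \o qtrace kappa); split.
- by rewrite cL cK -expnM -expnSr.
- by move=> x y /=; rewrite qtraceD // tauD.
- by move=> s x /=; rewrite qtraceZ // tauZ.
- move=> x /=; rewrite -[RHS]tauq; congr tau.
  apply: (fmorph_inj kappa); rewrite [RHS]rmorphXn /= !iota_qtrace //.
  have qL : [pchar L].-nat q.
    apply: pnat_dvd (pchar_nat_card L); rewrite cL cK -expnM dvdn_exp // muln_gt0.
    by rewrite expn_gt0.
  by rewrite exprDn_pchar // exprAC.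
split.
  split=> [|x y|] /=.
  - by rewrite -(rmorph0 kappa) tr_iota mulr0; exact: (add_char0 tauC).
  - by rewrite qtraceD //; exact: (add_charD tauC).
  (* The trace doubles elements of the smaller field, whence the factor [2^-1]. *)
  - have [x Hx] := add_char_nontrivial tauC; exists (kappa (2^-1 * x)).
    by rewrite tr_iota mulVKf.
move=> a b a0 b0 /=; rewrite -tauK // -cK.
have := kloosterman_quadratic kappa cL tauC (a := iota a) (b := iota b).
by rewrite !fmorph_eq0; apply.
Qed.

Hypothesis q_gt2 : (2 < q)%N.

(** With the term [s = 0] added, orthogonality turns the sum of the Kloosterman sums into [q] times
    the number of nonzero [x] where [tau (a x + b/x)] vanishes, which [trace_zero_card_lb] bounds
    from below. *)
Lemma kloosterman_iter_sum_ub a b j : a != 0 -> b != 0 ->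
  \sum_(s | s != 0) - kloosterman_iter q (kloosterman psi (s * a) (s * b)) j.+1
  <= (7 * q ^ 2 * q ^ (2 ^ j))%:R.
Proof.
move=> a0 b0.
have [L [iota [tau [cL tauD tauZ tauq [tauC tauK]]]]] := kloosterman_tower j.+1.
(* Stepanov's parameters are [D = q^(2^j - 1)] and [r = q D = q^(2^j)], so that [#|L| = r^2]. *)
have rD : (q ^ (2 ^ j) = q * q ^ (2 ^ j).-1)%N by rewrite -expnS prednK // expn_gt0.
have cL2 : #|L| = ((q * q ^ (2 ^ j).-1) ^ 2)%N by rewrite -rD -expnM -expnSr.
have := trace_zero_card_lb iota q_gt2 cL2 (iota b) (a := iota a) _ tauD tauq.
rewrite fmorph_eq0 => /(_ a0); rewrite -/q -rD cL; set N0 := [set x | _] => leL.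
have E : (q ^ (2 ^ j.+1))%:R - 1 - \sum_(s | s != 0)
    - kloosterman_iter q (kloosterman psi (s * a) (s * b)) j.+1 = (q * #|N0|)%:R.
  transitivity (\sum_s kloosterman (psi \o tau) (iota (s * a)) (iota (s * b))).
    rewrite [RHS](bigD1 0) //= sumrN opprK; congr (_ + _).
      rewrite /kloosterman (eq_bigr (fun _ => 1)) => [|x _]; last first.
        rewrite !mul0r rmorph0 !mul0r addr0 /=; exact: (add_char0 tauC).
      rewrite sumr_const cardC1 cL -subn1 natrB //.
      by rewrite expn_gt0 (ltn_trans _ q_gt2).
    by apply: eq_bigr => s s0; rewrite tauK ?mulf_neq0.
  rewrite /kloosterman exchange_big /=.
  rewrite (eq_bigr (fun x => (tau (iota a * x + iota b / x) == 0)%:R * q%:R)).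
    rewrite -mulr_suml mulrC natrM; congr (_ * _).
    rewrite -natr_sum -sum1_card; congr (_%:R).
    by rewrite -big_mkcondr /=; apply: eq_bigl => x; rewrite inE.
  move=> x x0; rewrite -(add_char_sumM psiC); apply: eq_bigr => s _; congr psi.
  by rewrite [RHS]mulrC -tauZ !rmorphM mulrDr !mulrA.
set S := (X in X <= _); have -> : S = (q ^ (2 ^ j.+1))%:R - 1 - (q * #|N0|)%:R.
  by rewrite -E opprB addrC subrK.
rewrite lerBlDr lerBlDr -natrD natr1 ler_nat addnC; exact: leqW.
Qed.


Lemma kloosterman_iter_real k j : k \is Num.real -> kloosterman_iter q k j \is Num.real.
Proof. by move=> kR; elim: j => //= j IH; rewrite rpredB ?rpredM ?rpredX ?realn. Qed.

(** The recursion rewrites minus the sum at level [j + 1] as the square at level [j] minus [2 r]. So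
    the previous bound controls a sum of nonnegative squares, and with it the one for [s = 1]. *)
Lemma kloosterman_iter_sqr_ub a b j : a != 0 -> b != 0 ->
  kloosterman_iter q (kloosterman psi a b) j ^+ 2 <= (9 * q ^ 2 * q ^ (2 ^ j))%:R.
Proof.
move=> a0 b0; set r := (q ^ (2 ^ j))%N.
pose k s := kloosterman_iter q (kloosterman psi (s * a) (s * b)) j.
have k2 s : 0 <= k s ^+ 2.
  by rewrite real_exprn_even_ge0 // kloosterman_iter_real // kloosterman_real.
have sumk : \sum_(s | s != 0) k s ^+ 2 <= (7 * q ^ 2 * r)%:R + (2 * q * r)%:R.
  have -> : \sum_(s | s != 0) k s ^+ 2 = \sum_(s | s != 0)
      - kloosterman_iter q (kloosterman psi (s * a) (s * b)) j.+1 +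
      \sum_(s : F | s != 0) (2 * r)%:R.
    rewrite -big_split /=; apply: eq_bigr => s _.
    by rewrite opprB natrM -/r subrK.
  apply: lerD; first exact: kloosterman_iter_sum_ub.
  rewrite sumr_const cardC1 -mulrnA ler_nat -[leqLHS]mulnA -[leqRHS]mulnA leq_mul2l /=.
  by rewrite [leqLHS]mulnC leq_mul2r leq_pred orbT.
apply: (@le_trans _ _ (\sum_(s | s != 0) k s ^+ 2)).
  rewrite (bigD1 1) ?oner_eq0 //= {1}/k !mul1r lerDl sumr_ge0 //.
apply: (le_trans sumk); rewrite -natrD ler_nat; nia.
Qed.

(** The normalised squares [y j] satisfy [y_(j+1) - 4 = y_j (y_j - 4)]. If [y_0 > 4], the excess
    over 4 at least quadruples at each step, against the uniform bound [9 q^2]. *)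
Theorem kloosterman_weil a b : a != 0 -> b != 0 -> kloosterman psi a b ^+ 2 <= 4 * q%:R.
Proof.
move=> a0 b0; set K := kloosterman psi a b.
have KR : K \is Num.real by apply: kloosterman_real.
have r0 j : 0 < (q ^ (2 ^ j))%:R :> algC by rewrite ltr0n expn_gt0 (ltn_trans _ q_gt2).
pose y j := kloosterman_iter q K j ^+ 2 / (q ^ (2 ^ j))%:R.
have yR j : y j \is Num.real by rewrite rpredM ?rpredX ?rpredV ?realn ?kloosterman_iter_real.
have yS j : y j.+1 - 4 = y j * (y j - 4).
  rewrite /y /= expnSr expnM [((q ^ _) ^ 2)%:R]natrX; move: (r0 j); set r := (q ^ _)%:R => r_gt0.
  field; exact: lt0r_neq0.
have y0 : y 0%N = K ^+ 2 / q%:R by rewrite /y /= expn0 expn1.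
have y_ub j : y j <= (9 * q ^ 2)%:R.
  by rewrite ler_pdivrMr // -natrM kloosterman_iter_sqr_ub.
have q0 : 0 < q%:R :> algC by rewrite ltr0n (ltn_trans _ q_gt2).
rewrite -ler_pdivrMr // -y0 real_leNgt ?realn ?yR //; apply/negP => y0_gt4.
have d_gt0 : 0 < y 0%N - 4 by rewrite subr_gt0.
have growth j : 4 ^+ j * (y 0%N - 4) <= y j - 4.
  elim: j => [|j IH]; first by rewrite expr0 mul1r.
  have yj : 0 <= y j - 4 by apply: le_trans IH; rewrite mulr_ge0 ?exprn_ge0 // ltW.
  rewrite yS exprS -mulrA; apply: ler_pM => //; last by rewrite -subr_ge0.
  by rewrite mulr_ge0 ?exprn_ge0 // ltW.
pose B := (9 * q ^ 2)%:R / (y 0%N - 4) : algC.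
have B0 : 0 <= B by apply: divr_ge0; [exact: ler0n | exact: ltW].
have := archi_boundP B0; set n := Num.bound B; rewrite ltr_pdivrMr // => Hn.
have : (9 * q ^ 2)%:R < (9 * q ^ 2)%:R :> algC; last by rewrite ltxx.
apply: (lt_le_trans Hn); apply: (le_trans _ (y_ub n)).
apply: (@le_trans _ _ (4 ^+ n * (y 0%N - 4))).
  by rewrite ler_pM2r // -natrX ler_nat ltnW // ltn_expl.
by apply: (le_trans (growth n)); rewrite lerBlDr lerDl.
Qed.

End Weil.

(** * Gauss and Salie sums *)

Section Gauss.

Variables (F : finFieldType) (psi : F -> algC).
Hypothesis psiC : add_char psi.
Hypothesis F2 : 2 != 0 :> F.
Let q := #|F|.

Let F4 : 4 != 0 :> F.
Proof. by rewrite -[4%N]/(2 * 2)%N natrM mulf_neq0. Qed.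

Definition gauss (s : F) : algC := \sum_u psi (s * u ^+ 2).

Lemma gauss_complete s m : s != 0 ->
  \sum_u psi (s * u ^+ 2 + m * u) = gauss s * psi (- m ^+ 2 / (4 * s)).
Proof.
move=> s0; rewrite /gauss mulr_suml (reindex_inj (addIr (- (m / (2 * s))))) /=.
apply: eq_bigr => u _; rewrite -add_charD //; congr psi.
by field; rewrite s0 F2 F4.
Qed.

Lemma gauss_conj s : (gauss s)^* = gauss (- s).
Proof.
rewrite /gauss rmorph_sum; apply: eq_bigr => u _.
by rewrite /= add_char_conj // mulNr.
Qed.

Lemma gauss_sqr_norm s : s != 0 -> gauss s * (gauss s)^* = q%:R.
Proof.
move=> s0; rewrite gauss_conj mulrC /gauss mulr_suml.
transitivity (\sum_u \sum_v psi (s * v ^+ 2 + (2 * s * v) * u)).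
  apply: eq_bigr => u _; rewrite mulr_sumr (reindex_inj (addrI u)) /=.
  by apply: eq_bigr => v _; rewrite -add_charD //; congr psi; ring.
rewrite exchange_big /=.
under eq_bigr => v _.
  under eq_bigr do rewrite add_charD //.
  rewrite -mulr_sumr add_char_sumM //.
  over.
rewrite (bigD1 0) //= big1 ?addr0 => [|v v0].
  by rewrite mulr0 eqxx expr0n /= mulr0 add_char0 // !mul1r.
by rewrite !mulf_eq0 (negPf F2) (negPf s0) (negPf v0) /= mul0r mulr0.
Qed.

Lemma gaussMsqr s c : c != 0 -> gauss (s * c ^+ 2) = gauss s.
Proof.
move=> c0; rewrite /gauss [RHS](reindex_inj (mulfI c0)) /=.
by apply: eq_bigr => u _; congr psi; ring.
Qed.

Lemma card_sqrt_leq2 (x e : F) : e != 0 -> (#|[set u | (e * u ^+ 2 == x)%R]| <= 2)%N.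
Proof.
move=> e0; have [u Hu | none] := pickP [pred u | e * u ^+ 2 == x]; last first.
  by rewrite (_ : [set u | _] = set0) ?cards0 //; apply/setP => u; rewrite !inE; exact: none.
apply: (@leq_trans #|[set u; - u]|); last by rewrite cards2; case: (_ != _).
apply: subset_leq_card; apply/subsetP => v; rewrite !inE -(eqP Hu).
by move/eqP/(mulfI e0)/eqP; rewrite eqf_sqr.
Qed.

(* Each sum is at most 2, and the sums add up to 2 * #|F|. *)
Lemma card_sqrt_nonsquare (e x : F) : (forall c, c ^+ 2 != e) ->
  (#|[set u | (1 * u ^+ 2 == x)%R]| + #|[set u | (e * u ^+ 2 == x)%R]| = 2)%N.
Proof.
move=> eN; have e0 : e != 0 by have := eN 0; rewrite expr0n eq_sym.
pose N c y := #|[set u : F | c * u ^+ 2 == y]|.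
have le2 y : (N 1%R y + N e y <= 2)%N.
  have [y0 | y0] := eqVneq y 0.
    suff N1 c : c != 0 -> N c y = 1%N by rewrite !N1 ?oner_eq0.
    move=> c0; apply/eqP/cards1P; exists 0; apply/setP => u.
    by rewrite !inE y0 mulf_eq0 (negPf c0) sqrf_eq0.
  have [z0 | [u]] := set_0Vmem [set u : F | 1 * u ^+ 2 == y].
    by rewrite /N z0 cards0 add0n; exact: card_sqrt_leq2.
  rewrite inE mul1r => /eqP Hu.
  rewrite [X in (_ + X)%N](_ : N e y = 0%N) ?addn0.
    by apply: card_sqrt_leq2; rewrite oner_eq0.
  apply/eqP; rewrite cards_eq0; apply/eqP/setP => v; rewrite !inE; apply/negP => /eqP Hv.
  have v0 : v != 0 by apply: contra_neq y0 => v0; rewrite -Hv v0 expr0n mulr0.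
  have /eqP := eN (u / v); apply; rewrite exprMn Hu -Hv exprVn mulfK //.
  by rewrite sqrf_eq0.
have /leqif_sum [_ Hsum] : forall y : F, xpredT y ->
    (N 1%R y + N e y <= 2 ?= iff (N 1%R y + N e y == 2))%N.
  by move=> y _; split.
move: Hsum; rewrite big_split /= sum_nat_const.
have sumfib c : (\sum_y N c y = #|F|)%N.
  rewrite -[RHS]sum1_card [RHS](partition_big (fun u => c * u ^+ 2) xpredT) //=.
  by apply: eq_bigr => y _; rewrite /N -sum1_card; apply: eq_bigl => u; rewrite inE.
by rewrite !sumfib muln2 -addnn eqxx => /esym/forallP/(_ x)/eqP.
Qed.

(** The values [u^2] and [e u^2] together cover each element exactly twice, so the two Gauss sums
    add up to twice a vanishing character sum. *)
Lemma gauss_nonsquare e s : (forall c, c ^+ 2 != e) -> s != 0 ->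
  gauss (e * s) = - gauss s.
Proof.
move=> eN s0; apply/eqP; rewrite -addr_eq0; apply/eqP.
have fib c : gauss (c * s) = \sum_x #|[set u | c * u ^+ 2 == x]|%:R * psi (s * x).
  rewrite -(sum_fibers xpredT (fun u => c * u ^+ 2) (fun x => psi (s * x))).
  by apply: eq_bigr => u _; congr psi; ring.
rewrite -{2}[s]mul1r !fib -big_split /=.
rewrite (eq_bigr (fun x => 2 * psi (s * x))) => [|x _].
  by rewrite -mulr_sumr add_char_sumM // (negPf s0) mul0r mulr0.
by rewrite -mulrDl -natrD addnC card_sqrt_nonsquare.
Qed.

Definition qchar (s : F) : algC :=
  if s == 0 then 0 else if [exists c, c ^+ 2 == s] then 1 else -1.

Lemma qchar0 : qchar 0 = 0. Proof. by rewrite /qchar eqxx. Qed.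

Lemma gaussE s : s != 0 -> gauss s = qchar s * gauss 1.
Proof.
move=> s0; rewrite /qchar (negPf s0); case: ifPn => [/existsP[c /eqP Hc]|].
  rewrite mul1r -Hc -[c ^+ 2]mul1r gaussMsqr //.
  by apply: contraNneq s0 => c0; rewrite -Hc c0 expr0n.
rewrite negb_exists => /forallP sN.
by rewrite -[s in LHS]mulr1 gauss_nonsquare ?oner_eq0 // mulN1r.
Qed.

Let q0 : q%:R != 0 :> algC.
Proof. by rewrite pnatr_eq0 -lt0n (ltn_trans _ (finNzRing_gt1 F)). Qed.

Lemma gauss1_neq0 : gauss 1 != 0.
Proof.
apply/eqP => G0; have := gauss_sqr_norm (oner_neq0 F).
by rewrite G0 mul0r => /esym/eqP; rewrite (negPf q0).
Qed.

Lemma qchar_sqr s : s != 0 -> qchar s ^+ 2 = 1.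
Proof. by move=> s0; rewrite /qchar (negPf s0); case: ifP; rewrite ?sqrrN expr1n. Qed.

(** Scaling the argument of a Gauss sum by [s] multiplies it by [qchar s], and [gauss 1] is
    nonzero. *)
Lemma qcharM s t : s != 0 -> t != 0 -> qchar (s * t) = qchar s * qchar t.
Proof.
move=> s0 t0; apply: (mulIf gauss1_neq0); rewrite -mulrA -!gaussE ?mulf_neq0 //.
rewrite /qchar (negPf s0); case: ifPn => [/existsP[c /eqP Hc]|].
  rewrite mul1r -Hc mulrC gaussMsqr //.
  by apply: contraNneq s0 => c0; rewrite -Hc c0 expr0n.
by rewrite negb_exists => /forallP sN; rewrite gauss_nonsquare // mulN1r.
Qed.

Lemma qcharX2 c : c != 0 -> qchar (c ^+ 2) = 1.
Proof.
move=> c0; rewrite /qchar sqrf_eq0 (negPf c0).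
by case: existsP => // -[]; exists c.
Qed.

Lemma qcharV s : s != 0 -> qchar s^-1 = qchar s.
Proof.
move=> s0; rewrite -[LHS]mulr1 -(qchar_sqr s0) expr2 mulrA -qcharM ?invr_eq0 //.
rewrite mulVf // (_ : qchar 1 = 1) ?mul1r //.
by rewrite -(expr1n F 2) qcharX2 ?oner_eq0.
Qed.

Definition salie (a b : F) : algC := \sum_(s | s != 0) qchar s * psi (a * s + b / s).

(** An element [x] has [1 + qchar x] square roots, and the constant 1 contributes nothing to the
    sum. *)
Lemma salie0 a : a != 0 -> \sum_s qchar s * psi (a * s) = gauss a.
Proof.
move=> a0; pose N x := #|[set u : F | u ^+ 2 == x]|.
have NE x : (N x)%:R = 1 + qchar x :> algC.
  rewrite /qchar; case: eqVneq => [->|x0].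
    rewrite addr0 (_ : N 0 = 1%N) //; apply/eqP/cards1P; exists 0; apply/setP => u.
    by rewrite !inE sqrf_eq0.
  case: ifPn => [/existsP[c /eqP Hc]|].
    have c0 : c != 0 by apply: contraNneq x0 => c0; rewrite -Hc c0 expr0n.
    rewrite /N (_ : [set u | _] = [set c; - c]); last first.
      by apply/setP => u; rewrite !inE -Hc eqf_sqr.
    rewrite cards2 (_ : c != - c) // -subr_eq0 opprK -mulr2n -mulr_natl.
    by rewrite mulf_neq0.
  rewrite negb_exists subrr => /forallP xN.
  by rewrite /N (_ : [set u | _] = set0) ?cards0 //; apply/setP => u; rewrite !inE (negPf (xN u)).
rewrite /gauss.
transitivity (\sum_x #|[set u | u ^+ 2 == x]|%:R * psi (a * x)); last first.
  by rewrite -(sum_fibers xpredT (fun u => u ^+ 2) (fun x => psi (a * x))).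
rewrite [RHS](eq_bigr (fun x => psi (a * x) + qchar x * psi (a * x))) => [|x _].
  by rewrite big_split /= add_char_sumM // (negPf a0) mul0r add0r.
by rewrite -/(N x) NE mulrDl mul1r.
Qed.

(** If [s] is in the fibre, so is [c^2 / s], and [v + 2 c] and [v - 2 c] are [(s + c)^2 / s] and
    [(s - c)^2 / s]: each has the character of [s] or vanishes. One vanishes exactly when the fibre
    is a single point. If the fibre is empty, [v^2 - 4 c^2] is a nonsquare, so the two characters
    are opposite. *)
Lemma qchar_fiber_sum (c v : F) : c != 0 ->
  \sum_(s | (s != 0) && (s + c ^+ 2 / s == v)) qchar s =
  qchar (v + 2 * c) + qchar (v - 2 * c).
Proof.
move=> c0.
have [s /andP[s0 /eqP sv] | none] := pickP [pred s | (s != 0) && (s + c ^+ 2 / s == v)].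
  have vp : v + 2 * c = (s + c) ^+ 2 * s^-1 by rewrite -sv; field.
  have vm : v - 2 * c = (s - c) ^+ 2 * s^-1 by rewrite -sv; field.
  have qsqr (z : F) : qchar (z ^+ 2 * s^-1) = if z == 0 then 0 else qchar s.
    have [->|z0] := eqVneq z 0; first by rewrite expr0n mul0r qchar0.
    by rewrite qcharM ?sqrf_eq0 ?invr_eq0 // qcharX2 // qcharV // mul1r.
  have c2s : c ^+ 2 / s != 0 by rewrite mulf_neq0 ?sqrf_eq0 ?invr_eq0.
  have q' : qchar (c ^+ 2 / s) = qchar s by rewrite qsqr (negPf c0).
  have in_fib (t : F) : (t != 0) && (t + c ^+ 2 / t == v) = (t == s) || (t == c ^+ 2 / s).
    have [->|t0] := eqVneq t 0; first by rewrite ![0 == _]eq_sym (negPf s0) (negPf c2s).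
    rewrite /= -subr_eq0 -sv -[t == s]subr_eq0 -[t == c ^+ 2 / s]subr_eq0 -mulf_eq0.
    have -> : t + c ^+ 2 / t - (s + c ^+ 2 / s) = (t - s) * (t - c ^+ 2 / s) * t^-1.
      by field; rewrite t0.
    by rewrite [LHS]mulf_eq0 invr_eq0 (negPf t0) orbF.
  rewrite (eq_bigl _ _ in_fib) vp vm !qsqr addr_eq0 subr_eq0 -[s == - c]addr_eq0.
  have [sc | sc] := eqVneq (s ^+ 2) (c ^+ 2).
    have -> : c ^+ 2 / s = s by rewrite -sc expr2 mulfK.
    under eq_bigl do rewrite orbb; rewrite big_pred1_eq.
    move/eqP: sc; rewrite eqf_sqr => /orP[/eqP sc | /eqP sc].
      have [->|sc'] := eqVneq s c; last by rewrite sc eqxx in sc'.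
      by rewrite -mulr2n -mulr_natl mulf_eq0 (negPf F2) (negPf c0) addr0.
    rewrite addr_eq0 sc eqxx add0r -subr_eq0 -opprD oppr_eq0 -mulr2n -mulr_natl.
    by rewrite mulf_eq0 (negPf F2) (negPf c0).
  have [-> ->] : (s == c) = false /\ (s + c == 0) = false.
    by move: sc; rewrite eqf_sqr negb_or addr_eq0 => /andP[/negPf-> /negPf->].
  rewrite (bigD1 s) ?eqxx //= (bigD1 (c ^+ 2 / s)) /= ?eqxx ?orbT //=; last first.
    apply: contra_neq sc => E; rewrite expr2 -{1}E divfK //.
  rewrite big1 => [|t]; first by rewrite addr0 q'.
  by move=> /andP[/andP[/orP[]/eqP->]]; rewrite eqxx.
rewrite big_pred0 //; have nofib s : s != 0 -> s + c ^+ 2 / s != v.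
  by move=> s0; have := none s; rewrite /= s0 /= => ->.
have vp : v + 2 * c != 0.
  apply/negP; rewrite addr_eq0 => /eqP vE.
  have := nofib (- c); rewrite oppr_eq0 => /(_ c0)/eqP; apply; rewrite vE; field.
  by rewrite oppr_eq0.
have vm : v - 2 * c != 0.
  apply/negP; rewrite subr_eq0 => /eqP vE.
  by have /eqP := nofib c c0; apply; rewrite vE; field.
have pm (z : F) : z != 0 -> qchar z = 1 \/ qchar z = -1.
  by move=> z0; rewrite /qchar (negPf z0); case: ifP; [left | right].
have neq : qchar (v + 2 * c) * qchar (v - 2 * c) != 1.
  rewrite -qcharM // /qchar mulf_eq0 (negPf vp) (negPf vm) /=; case: existsP => [[w /eqP Hw]|_].
    pose s := (v + w) / 2.
    have sE : s * (v - s) = c ^+ 2.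
      have -> : s * (v - s) = (v ^+ 2 - w ^+ 2) / 4 by rewrite /s; field; rewrite F2 F4.
      by rewrite Hw; field.
    have s0 : s != 0 by apply: contraNneq c0 => s0; rewrite -sqrf_eq0 -sE s0 mul0r.
    by have /eqP := nofib s s0; case; rewrite -sE mulrC mulKf // addrC subrK.
  by rewrite eq_sym -subr_eq0 opprK -[1 + 1]/(2%:R) pnatr_eq0.
move: neq; case: (pm _ vp) => ->; case: (pm _ vm) => ->; rewrite ?mulrNN ?mul1r ?eqxx //.
  by rewrite subrr.
by rewrite addNr.
Qed.

(** Grouping by [v = s + c^2 / s] makes the phase linear in [v], which leaves two translates of the
    sum in [salie0]. *)
Lemma salie_sqr a c : a != 0 -> c != 0 ->
  salie a (a * c ^+ 2) = (psi (2 * a * c) + psi (- (2 * a * c))) * gauss a.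
Proof.
move=> a0 c0; rewrite /salie.
rewrite (partition_big (fun s => s + c ^+ 2 / s) xpredT) //=.
transitivity (\sum_v (qchar (v + 2 * c) + qchar (v - 2 * c)) * psi (a * v)).
  apply: eq_bigr => v _; rewrite -qchar_fiber_sum // mulr_suml.
  apply: eq_bigr => s /andP[s0 /eqP <-]; congr (_ * psi _).
  by rewrite mulrDr mulrA.
have shift (w : F) : \sum_v qchar (v + w) * psi (a * v) = psi (- (a * w)) * gauss a.
  rewrite -salie0 // (reindex_inj (addIr (- w))) mulr_sumr /=.
  apply: eq_bigr => v _; rewrite subrK mulrCA -add_charD //; congr (_ * psi _).
  by ring.
transitivity (\sum_v qchar (v + 2 * c) * psi (a * v) +
  \sum_v qchar (v + - (2 * c)) * psi (a * v)).
  by rewrite -big_split /=; apply: eq_bigr => v _; rewrite mulrDl.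
rewrite !shift -mulrDl addrC; congr ((psi _ + psi _) * _); ring.
Qed.

(** The substitution of [(b / a) / s] for [s] preserves the phase and changes the sign of
    [qchar s]. *)
Lemma salie_nonsquare a b : a != 0 -> b != 0 -> (forall c, c ^+ 2 != b / a) ->
  salie a b = 0.
Proof.
move=> a0 b0 bN; have ba0 : b / a != 0 by rewrite mulf_neq0 ?invr_eq0.
have qba : qchar (b / a) = -1.
  rewrite /qchar (negPf ba0); case: existsP => // -[c Hc].
  by have := bN c; rewrite Hc.
suff E : salie a b = - salie a b.
  by apply/eqP; have /eqP := E; rewrite -addr_eq0 -mulr2n -mulr_natl mulf_eq0 pnatr_eq0.
rewrite {1}/salie.
rewrite (reindex_onto (fun s => b / a / s) (fun s => b / a / s)) /=; last first.
  by move=> s s0; rewrite invf_div mulrC divfK.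
rewrite /salie -sumrN; apply: eq_big => s.
  rewrite mulf_eq0 (negPf ba0) invr_eq0 /=; case: eqVneq => //= s0.
  by rewrite invf_div mulrC divfK ?eqxx.
have [-> | s0 _] := eqVneq s 0; first by rewrite invr0 mulr0 eqxx.
rewrite qcharM ?invr_eq0 // qba qcharV // mulN1r mulNr; congr (- (_ * psi _)).
by field; rewrite a0 b0 s0.
Qed.

Lemma gauss_norm s : s != 0 -> `|gauss s| = sqrtC q%:R.
Proof.
move=> s0; apply/eqP; rewrite -(@eqrXn2 _ 2) ?sqrtC_ge0 ?ler0n //.
by rewrite sqrtCK normCK gauss_sqr_norm.
Qed.

Lemma salie_norm a b : a != 0 -> `|salie a b| <= 2 * sqrtC q%:R.
Proof.
move=> a0; have h0 : 0 <= sqrtC (q%:R : algC) by rewrite sqrtC_ge0 ler0n.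
have [-> | b0] := eqVneq b 0.
  have -> : salie a 0 = gauss a.
    rewrite -salie0 // [RHS](bigD1 0) //= qchar0 mul0r add0r.
    by apply: eq_bigr => s _; rewrite mul0r addr0.
  by rewrite gauss_norm // mulr_natl mulr2n lerDl.
have [c Hc | none] := pickP [pred c | c ^+ 2 == b / a]; last first.
  by rewrite salie_nonsquare ?normr0 ?mulr_ge0 // => c; apply/negbT/none.
have bE : b = a * c ^+ 2 by rewrite (eqP Hc) mulrC divfK.
have c0 : c != 0 by apply: contraNneq b0 => c0; rewrite bE c0 expr0n mulr0.
rewrite bE salie_sqr // normrM gauss_norm // ler_wpM2r //.
by apply: (le_trans (ler_normD _ _)); rewrite !add_char_norm.
Qed.

End Gauss.

(** * Counting distances *)

Section IosevichRudnev.

Variables (F : finFieldType) (psi : F -> algC).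
Hypothesis psiC : add_char psi.
Hypothesis F2 : 2 != 0 :> F.
Let q := #|F|.
Hypothesis q_gt2 : (2 < q)%N.
Variable d : nat.

Let F4 : 4 != 0 :> F.
Proof. by rewrite -[4%N]/(2 * 2)%N natrM mulf_neq0. Qed.

Lemma sum_row_prod (f : 'I_d -> F -> algC) :
  \sum_(x : 'rV[F]_d) \prod_i f i (x 0 i) = \prod_i \sum_u f i u.
Proof.
rewrite bigA_distr_bigA /= (reindex (fun g : {ffun 'I_d -> F} => \row_i g i)) /=.
  by apply: eq_bigr => g _; apply: eq_bigr => i _; rewrite mxE.
exists (fun x : 'rV[F]_d => [ffun i => x 0 i]) => [g _ | x _].
  by apply/ffunP => i; rewrite ffunE mxE.
by apply/rowP => i; rewrite mxE ffunE.
Qed.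

Lemma add_char_bigsum (I : Type) (s : seq I) (P : pred I) (f : I -> F) :
  psi (\sum_(i <- s | P i) f i) = \prod_(i <- s | P i) psi (f i).
Proof. exact: (big_morph psi (add_charD psiC) (add_char0 psiC)). Qed.

Definition dot (m x : 'rV[F]_d) : F := \sum_i m 0 i * x 0 i.

Lemma add_char_dot_sum (z : 'rV[F]_d) :
  \sum_m psi (dot m z) = (z == 0)%:R * q%:R ^+ d.
Proof.
under eq_bigr do rewrite /dot add_char_bigsum.
rewrite (sum_row_prod (fun i u => psi (u * z 0 i))).
under eq_bigr => i _.
  under eq_bigr do rewrite mulrC.
  rewrite add_char_sumM //; over.
have [->|/rV0Pn [i zi]] := eqVneq z 0.
  under eq_bigr do rewrite mxE eqxx mul1r.
  by rewrite prodr_const card_ord mul1r.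
by rewrite mul0r (bigD1 i) //= (negPf zi) !mul0r.
Qed.

(** The Fourier expansion of a Gaussian. The square is completed in each coordinate, and [gauss s]
    times its conjugate is [q]. *)
Lemma add_char_sqnorm_fourier s (z : 'rV[F]_d) : s != 0 ->
  q%:R ^+ d * psi (s * sqnorm z) =
  gauss psi s ^+ d * \sum_m psi (- sqnorm m / (4 * s) + dot m z).
Proof.
move=> s0; have s4 : - (4 * s)^-1 != 0 by rewrite oppr_eq0 invr_eq0 mulf_neq0.
have coord_sum i : \sum_u psi (- (4 * s)^-1 * u ^+ 2 + z 0 i * u) =
    (gauss psi s)^* * psi (s * z 0 i ^+ 2).
  rewrite gauss_complete // gauss_conj //; congr (_ * psi _).
    (* As [-(4 s)^-1] is [-s] times the square of [(2 s)^-1], both have the same Gauss sum. *)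
    rewrite -(gaussMsqr psi (- s) (c := (2 * s)^-1)); last first.
      by rewrite invr_eq0 mulf_neq0.
    by congr (gauss psi _); field; rewrite s0 F2 F4.
  by field; rewrite oppr_eq0 oner_eq0 s0 F4.
have -> : \sum_m psi (- sqnorm m / (4 * s) + dot m z) =
    \prod_i \sum_u psi (- (4 * s)^-1 * u ^+ 2 + z 0 i * u).
  rewrite -sum_row_prod; apply: eq_bigr => m _; rewrite -add_char_bigsum; congr psi.
  rewrite /sqnorm /dot -sumrN mulr_suml -big_split /=.
  by apply: eq_bigr => i _; rewrite mulNr [_ / _]mulrC -mulNr [z 0 i * _]mulrC.
under [in RHS]eq_bigr do rewrite coord_sum.
rewrite big_split /= prodr_const card_ord mulrA -exprMn gauss_sqr_norm //.
by rewrite -add_char_bigsum mulr_sumr.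
Qed.

(** The factor [qchar s ^+ d] stems from [gauss s ^+ d]; only the parity of [d] matters, which
    separates Salie from Kloosterman sums. *)
Definition mixed_sum (a b : F) : algC :=
  \sum_(s | s != 0) qchar s ^+ d * psi (a * s + b / s).

Let h : algC := sqrtC q%:R.
Let h_ge1 : 1 <= h.
Proof. by rewrite -sqrtC1 ler_sqrtC ?nnegrE ?ler01 ?ler0n // ler1n ltnW // ltnW. Qed.
Let h_ge0 : 0 <= h. Proof. exact: le_trans ler01 h_ge1. Qed.

Lemma kloosterman_norm a b : a != 0 -> `|kloosterman psi a b| <= 2 * h.
Proof.
move=> a0; have [->|b0] := eqVneq b 0.
  suff -> : kloosterman psi a 0 = -1.
    by rewrite normrN1 mulr_natl mulr2n (le_trans h_ge1) // lerDl.
  have := add_char_sumM psiC a; rewrite (bigD1 0) //= (negPf a0) mul0r mulr0 (add_char0 psiC).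
  move/eqP; rewrite addrC addr_eq0 => /eqP <-; rewrite /kloosterman.
  by apply: eq_bigr => s _; rewrite mul0r addr0.
rewrite -(@ler_pXn2r _ 2) ?nnegrE ?mulr_ge0 //.
rewrite exprMn sqrtCK real_normK ?kloosterman_real // -natrX.
exact: kloosterman_weil.
Qed.

Lemma mixed_sum_norm a b : a != 0 -> `|mixed_sum a b| <= 2 * h.
Proof.
move=> a0; have dE := odd_double_half d.
have qd s : s != 0 -> qchar s ^+ d = qchar s ^+ (odd d).
  by move=> s0; rewrite -{1}dE exprD -mul2n exprM qchar_sqr // expr1n mulr1.
have -> : mixed_sum a b = if odd d then salie psi a b else kloosterman psi a b.
  rewrite /mixed_sum; case: ifP => od; apply: eq_bigr => s s0; rewrite qd // od.
    by rewrite expr1.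
  by rewrite expr0 mul1r.
case: ifP => _; last exact: kloosterman_norm.
exact: salie_norm.
Qed.

Definition dist_pairs (E : {set 'rV[F]_d}) (t : F) :=
  [set z in setX E E | sqnorm (z.1 - z.2) == t].

(** The condition on the distance is detected by a sum over characters, whose term [s = 0] is the
    main term. In the rest, Fourier expansion gives weights [A m] times mixed sums with first
    parameter [-t], nonzero as the bound demands. *)
Theorem iosevich_rudnev (E : {set 'rV[F]_d}) t : t != 0 ->
  `|q%:R * #|dist_pairs E t|%:R - #|E|%:R ^+ 2| <= 2 * h ^+ d.+1 * #|E|%:R.
Proof.
move=> t0; pose EE := setX E E.
pose f (s : F) (z : 'rV[F]_d * 'rV[F]_d) := psi ((sqnorm (z.1 - z.2) - t) * s).
pose R := \sum_(s | s != 0) \sum_(z in EE) f s z.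
pose A m := \sum_(z in EE) psi (dot m (z.1 - z.2)).
have -> : q%:R * #|dist_pairs E t|%:R - #|E|%:R ^+ 2 = R.
  apply/eqP; rewrite subr_eq addrC; apply/eqP.
  transitivity (\sum_s \sum_(z in EE) f s z); last first.
    rewrite (bigD1 0) //=; congr (_ + _).
    rewrite (eq_bigr (fun _ => 1)) => [|z _]; last by rewrite /f mulr0 add_char0.
    by rewrite sumr_const cardsX natrM expr2.
  rewrite exchange_big /= (eq_bigr (fun z : 'rV[F]_d * 'rV[F]_d =>
    (sqnorm (z.1 - z.2) == t)%:R * q%:R)) => [|z _]; last first.
    by rewrite /f add_char_sumM // subr_eq0.
  rewrite -mulr_suml mulrC; congr (_ * _); rewrite -natr_sum -sum1_card.
  congr (_%:R); rewrite -big_mkcondr /=; by apply: eq_bigl => z; rewrite [LHS]inE.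
(* [A m] is the squared modulus of a Fourier coefficient of [E]. *)
have A_ge0 m : 0 <= A m.
  pose e := \sum_(x in E) psi (dot m x).
  suff -> : A m = e * e^* by rewrite mul_conjC_ge0.
  rewrite /e rmorph_sum mulr_suml; under eq_bigr do rewrite mulr_sumr.
  rewrite pair_big /= /A; apply: eq_big => [z|z _]; first by rewrite inE.
  rewrite /= add_char_conj // -add_charD //; congr psi.
  by rewrite /dot -sumrB; apply: eq_bigr => i _; rewrite !mxE mulrBr.
(* Plancherel's identity for the indicator function of [E]. *)
have A_sum : \sum_m A m = q%:R ^+ d * #|E|%:R.
  rewrite /A exchange_big /=; under eq_bigr do rewrite add_char_dot_sum subr_eq0.
  rewrite -mulr_suml mulrC; congr (_ * _); rewrite -natr_sum; congr (_%:R).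
  rewrite -big_mkcondr /= -sum1_card.
  rewrite (reindex_onto (fun x => (x, x)) fst) /=; last by case=> x y /= /andP[_ /eqP->].
  by apply: eq_bigl => x; rewrite !inE !eqxx !andbT andbb.
have RE : q%:R ^+ d * R = \sum_m A m * (gauss psi 1 ^+ d * mixed_sum (- t) (- sqnorm m / 4)).
  transitivity (\sum_(s | s != 0) \sum_(z in EE) \sum_m
     (psi (dot m (z.1 - z.2)) * (gauss psi 1 ^+ d * (qchar s ^+ d *
       psi (- t * s + - sqnorm m / 4 / s))))).
    rewrite /R mulr_sumr; apply: eq_bigr => s s0; rewrite mulr_sumr.
    apply: eq_bigr => z _.
    rewrite /f mulrBl add_charD // mulrA [_ * s]mulrC add_char_sqnorm_fourier //.
    rewrite mulr_sumr mulr_suml; apply: eq_bigr => m _.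
    rewrite add_charD // (gaussE psiC s0) exprMn [psi (- t * s + _)]add_charD // -mulNr.
    have -> : - sqnorm m / (4 * s) = - sqnorm m / 4 / s by rewrite invfM mulrA.
    ring.
  rewrite exchange_big /=.
  under eq_bigr do rewrite exchange_big /=.
  rewrite exchange_big /=; apply: eq_bigr => m _.
  rewrite /A mulr_suml; apply: eq_bigr => z _.
  by rewrite /mixed_sum !mulr_sumr.
have qd0 : 0 < q%:R ^+ d :> algC by rewrite exprn_gt0 // ltr0n (ltn_trans _ q_gt2).
rewrite -(ler_pM2l qd0) -{1}(gtr0_norm qd0) -normrM RE.
apply: (le_trans (ler_norm_sum _ _ _)).
apply: (@le_trans _ _ (\sum_m A m * (h ^+ d * (2 * h)))).
  apply: ler_sum => m _; rewrite normrM ger0_norm // ler_wpM2l //.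
  rewrite normrM normrX gauss_norm ?oner_eq0 // ler_wpM2l ?exprn_ge0 //.
  by apply: mixed_sum_norm; rewrite oppr_eq0.
rewrite -mulr_suml A_sum exprS le_eqVlt; apply/orP; left; apply/eqP; ring.
Qed.

(** Squaring removes the square root of [q], so the bound becomes one between integers and can pass
    from [algC] to any real field. *)
Corollary dist_pairs_ineq (E : {set 'rV[F]_d}) t : t != 0 ->
  (((q * #|dist_pairs E t|)%:Z - (#|E| ^ 2)%:Z) ^+ 2 <= (4 * q ^ d.+1 * #|E| ^ 2)%:Z)%R.
Proof.
move=> t0; have := iosevich_rudnev E t0.
rewrite -(@ler_pXn2r _ 2) ?nnegrE ?mulr_ge0 ?exprn_ge0 ?ler0n //.
rewrite real_normK; last by rewrite rpredB ?rpredM ?rpredX ?realn.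
have -> : (2 * h ^+ d.+1 * #|E|%:R) ^+ 2 = (4 * q ^ d.+1 * #|E| ^ 2)%:R :> algC.
  by rewrite !exprMn [h ^+ d.+1 ^+ 2]exprAC sqrtCK -!natrX -!natrM.
by rewrite -(ler_int algC) rmorphXn rmorphB /= -!pmulrn [(q * _)%:R]natrM [(#|E| ^ 2)%:R]natrX.
Qed.

End IosevichRudnev.

(** * Points of spheres with many zero coordinates, and the conclusion *)

Section ZeroCoordinates.

Variables (F : finFieldType) (d : nat).
Let q := #|F|.

Lemma card_vanishing_leq (A : {set 'I_d}) :
  (#|[set w : 'rV[F]_d | [forall i in A, w ord0 i == 0%R]]| <= q ^ (d - #|A|))%N.
Proof.
pose f (w : 'rV[F]_d) := [ffun i => w 0 i].
have finj : injective f.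
  by move=> w w' /ffunP E; apply/rowP => i; have := E i; rewrite !ffunE.
have -> : (d - #|A|)%N = #|~: A| by rewrite [RHS]cardsCs setCK card_ord.
rewrite -(card_imset _ finj) -(card_pffun_on (0 : F)).
apply: subset_leq_card; apply/subsetP => _ /imsetP[w wA ->].
apply/pffun_onP; split=> //; apply/subsetP => i; rewrite !inE ffunE.
by apply: contra => iA; move: wA; rewrite inE => /forall_inP/(_ i iA).
Qed.

(** A coordinate outside [A] is erased: the rest vanishes on one more index and determines the
    square of the erased entry, which leaves at most two choices. *)
Lemma card_sphere_zero_set (A : {set 'I_d}) (t : F) : t != 0 -> (#|A| < d)%N ->
  (#|[set z : 'rV[F]_d | ([set i | z ord0 i == 0%R] == A) && (sqnorm z == t)]|
     <= 2 * q ^ (d - #|A|.+1))%N.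
Proof.
move=> t0 Ad; have [i iA] : exists i, i \notin A.
  apply/existsP; apply: contraLR Ad; rewrite negb_exists -leqNgt => /forallP AT.
  apply: (@leq_trans #|'I_d|); first by rewrite card_ord.
  apply: subset_leq_card; apply/subsetP => i _.
  by rewrite -[_ \in _]negbK AT.
set Z := [set z | _].
pose f (z : 'rV[F]_d) := \row_j (if j == i then 0 else z 0 j).
pose B := [set w : 'rV[F]_d | [forall j in i |: A, w ord0 j == 0]].
have cB : (#|B| <= q ^ (d - #|A|.+1))%N.
  by have := card_vanishing_leq (i |: A); rewrite cardsU1 iA.
apply: (@leq_trans (2 * #|B|)); last by rewrite leq_mul2l cB orbT.
apply: (card_leq_fibers (f := f)) => [z|w _].
  rewrite inE => /andP[/eqP zA _]; rewrite inE; apply/forall_inP => j.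
  by rewrite !inE mxE; case: eqP => //= _; rewrite -zA inE.
have fE z j : f z = w -> j != i -> z 0 j = w 0 j.
  by move=> /rowP/(_ j); rewrite mxE => + /negPf ji; rewrite ji.
pose x := t - \sum_(j | j != i) w 0 j ^+ 2.
apply: leq_trans (@card_sqrt_leq2 F x 1 (oner_neq0 _)).
rewrite -(card_in_imset (f := fun z : 'rV[F]_d => z 0 i)); last first.
  move=> z z'; rewrite !inE => /andP[_ /eqP fz] /andP[_ /eqP fz'] zz'.
  apply/rowP => j; have [->//|ji] := eqVneq j i.
  by rewrite (fE _ _ fz) // (fE _ _ fz').
apply: subset_leq_card; apply/subsetP => _ /imsetP[z + ->].
rewrite !inE mul1r => /andP[/andP[_ /eqP zt] /eqP fz].
rewrite /x -zt /sqnorm (bigD1 i) //= -addrA [X in _ + X](_ : _ = 0) ?addr0 //.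
by apply/eqP; rewrite subr_eq0; apply/eqP/eq_bigr => j ji; rewrite (fE _ _ fz).
Qed.

(** The zero set has at least [k] elements, and fewer than [d] because [t] is nonzero; each of the
    [2^d] candidates accounts for at most [2 q^(d-k-1)] points. *)
Lemma card_sphere_many_zeros (k : nat) (t : F) : t != 0 -> (1 < q)%N ->
  (q * #|[set z : 'rV[F]_d | (k <= nzeros z) && (sqnorm z == t)%R]|
     <= 2 ^ d.+1 * q ^ (d - k))%N.
Proof.
move=> t0 q1; set Z := [set z | _].
have [dk | kd] := leqP d k.
  rewrite (_ : Z = set0) ?cards0 ?muln0 //; apply/setP => z; rewrite !inE.
  apply/negP => /andP[kz /eqP zt]; case/eqP: t0; rewrite -zt /sqnorm big1 // => i _.
  have /eqP/setP/(_ i) : [set i : 'I_d | z 0 i == 0] == [set: 'I_d].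
    rewrite eqEcard subsetT cardsT card_ord; exact: leq_trans dk kz.
  by rewrite !inE => /eqP->; rewrite expr0n.
have : (#|Z| <= 2 * q ^ (d - k.+1) * #|[set: {set 'I_d}]|)%N.
  apply: (card_leq_fibers (f := fun z : 'rV[F]_d => [set i | z 0 i == 0])) => [z|A _].
    by rewrite inE.
  have [kA | Ak] := leqP k #|A|; last first.
    rewrite (_ : [set x in Z | _] = set0) ?cards0 //; apply/setP => z; rewrite !inE.
    by apply/negP => /andP[/andP[kz _] /eqP zA]; move: kz; rewrite /nzeros zA leqNgt Ak.
  have [dA | Ad] := leqP d #|A|.
    rewrite (_ : [set x in Z | _] = set0) ?cards0 //; apply/setP => z; rewrite !inE.
    apply/negP => /andP[/andP[_ /eqP zt] /eqP zA]; case/eqP: t0.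
    rewrite -zt /sqnorm big1 // => i _.
    have /eqP/setP/(_ i) : A == [set: 'I_d] by rewrite eqEcard subsetT cardsT card_ord.
    by rewrite -zA !inE => /eqP->; rewrite expr0n.
  apply: (@leq_trans (2 * q ^ (d - #|A|.+1))).
    apply: leq_trans (card_sphere_zero_set t0 Ad).
    by apply: subset_leq_card; apply/subsetP => z; rewrite !inE => /andP[/andP[_ ->] ->].
  by rewrite leq_mul2l leq_exp2l // leq_sub2l // ltnS.
rewrite -powersetT card_powerset cardsT card_ord => leZ.
apply: (@leq_trans (q * (2 * q ^ (d - k.+1) * 2 ^ d))); first by rewrite leq_mul2l leZ orbT.
rewrite -(subnSK kd) !expnS; apply: eq_leq; ring.
Qed.

End ZeroCoordinates.

(** If [t] is missed, all pairs at distance [t] are bad. So [N], which is [q] times their number, is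
    small, while the count of distances puts it close to [#|E|^2]. Smallness follows by sending a
    pair [(x, y)] to [(x, x - y)]. *)
Lemma not_kdist_ineq (F : finFieldType) (d k : nat) (E : {set 'rV[F]_d}) (t : F) :
    2 != 0 :> F -> (2 < #|F|)%N -> (0 < k)%N -> t != 0 -> t \notin kdist k E ->
  exists2 N : nat, (N <= #|E| * (2 ^ d.+1 * #|F| ^ (d - k)))%N &
    (N%:Z - (#|E| ^ 2)%:Z) ^+ 2 <= (4 * #|F| ^ d.+1 * #|E| ^ 2)%:Z.
Proof.
move=> F2 F3 k0 t0 tk; have [psi psiC] := add_char_exists F.
exists (#|F| * #|dist_pairs E t|)%N; last exact: (dist_pairs_ineq psiC).
pose Z := [set z : 'rV[F]_d | (k <= nzeros z)%N && (sqnorm z == t)].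
suff le : (#|dist_pairs E t| <= #|E| * #|Z|)%N.
  have := card_sphere_many_zeros d k t0 (ltnW F3); rewrite -/Z => leZ.
  apply: (@leq_trans (#|F| * (#|E| * #|Z|))); first by rewrite leq_mul2l le orbT.
  by rewrite mulnCA leq_mul2l leZ orbT.
rewrite -cardsX -(card_imset (dist_pairs E t) (f := fun z => (z.1, z.1 - z.2))); last first.
  by move=> [x y] [x' y'] /= [-> /addrI/oppr_inj->].
apply: subset_leq_card; apply/subsetP => _ /imsetP[[x y] + ->].
rewrite !inE /= => /andP[/andP[xE yE] xyt]; rewrite xE xyt andbT /= leqNgt.
apply: contra tk => zk; apply/imset2P; exists x y => //.
rewrite /knorm ifT ?(eqP xyt) //; move: zk k0; lia.
Qed.

Theorem theorem1p4 (R : realType) (d k : nat)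
    (hd : (2 <= d)%N) (hk : (1 <= k <= d)%N) :
  exists C : R, 0 < C /\
    forall (p n q : nat) (F : finFieldType),
      prime p -> odd p -> (0 < n)%N -> q = (p ^ n)%N -> #|F| = q ->
    forall E : {set 'rV[F]_d},
      C * powR q%:R (Num.max ((d%:R + 1) / 2) (d%:R - k%:R)) <= #|E|%:R ->
      kdist k E = [set: F].
Proof.
pose B : R := (2 ^ d.+1)%:R.
have B_gt0 : 0 < B by rewrite ltr0n expn_gt0.
(* [B] pays for the bad pairs and 2 for the error term, so a missed distance gives
   [#|E| <= (B + 2) P]; one more unit makes this contradictory. *)
exists (B + 3); split; first by rewrite addr_gt0.
move=> p n q F pr_p odd_p n_gt0 qE cardF E.
have F2 : 2 != 0 :> F.
  apply/negP => F20; have := card_finPcharP (etrans cardF qE) pr_p.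
  move/pcharf_eq/(_ 2); rewrite !inE /= F20 => /esym/eqP p2.
  by rewrite -p2 in odd_p.
have p_gt2 : (2 < p)%N by apply: odd_prime_gt2.
have q_gt2 : (2 < q)%N.
  apply: (leq_trans p_gt2); rewrite qE -(prednK n_gt0) expnS leq_pmulr //.
  by rewrite expn_gt0 (ltn_trans _ p_gt2).
have q_ge1 : 1 <= q%:R :> R by rewrite ler1n; lia.
case/andP: hk => k_gt0 kd; set M := Num.max _ _; set P := powR q%:R M.
have P_gt0 : 0 < P by rewrite powR_gt0 // ltr0n; lia.
pose H := powR (q%:R : R) ((d%:R + 1) / 2).
have H_ge0 : 0 <= H by exact: powR_ge0.
have HP : H <= P by rewrite ler_powR // le_max lexx.
have qdkP : (q ^ (d - k))%:R <= P.
  rewrite natrX -powR_mulrn ?ler0n // ler_powR // natrB // le_max lexx.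
  by rewrite orbT.
have H2 : H ^+ 2 = (q ^ d.+1)%:R.
  rewrite -powR_mulrn // -powRrM divfK ?pnatr_eq0 // natr1 powR_mulrn ?ler0n //.
  by rewrite -natrX.
set e : R := #|E|%:R => leE.
have e_gt0 : 0 < e by apply: lt_le_trans leE; rewrite mulr_gt0 // addr_gt0.
have E_gt0 : (0 < #|E|)%N by rewrite -(ltr0n R).
apply/setP => t; rewrite inE; apply/negPn/negP => tk.
have [t0 | t0] := eqVneq t 0.
  (* The distance 0 is that of a point of [E] to itself, in either branch of [knorm]. *)
  case/negP: tk; have [x xE] := card_gt0P E_gt0; apply/imset2P; exists x x => //.
  rewrite subrr t0 /knorm /sqnorm; case: ifP => // _.
  by rewrite big1 // => i _; rewrite mxE expr0n.
have := not_kdist_ineq F2 _ k_gt0 t0 tk; rewrite cardF => /(_ q_gt2)[N leN ineq].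
have leN' : N%:R <= e * (B * P).
  apply: (@le_trans _ _ (e * (B * (q ^ (d - k))%:R))).
    by rewrite /e /B -!natrM ler_nat.
  by rewrite !ler_wpM2l // ltW.
have : (e ^+ 2 - N%:R) ^+ 2 <= (2 * H * e) ^+ 2.
  rewrite !exprMn H2 /e -!natrX -!natrM -[leLHS]sqrrN opprB.
  by move: ineq; rewrite -(ler_int R) rmorphXn rmorphB /= -!pmulrn.
have HE : 0 <= 2 * H * e by rewrite !mulr_ge0 // ltW.
move=> sq; have : e ^+ 2 - N%:R <= 2 * H * e.
  have [neg | pos] := leP (e ^+ 2 - N%:R) 0; first exact: le_trans neg HE.
  by rewrite -(@ler_pXn2r _ 2) // nnegrE // ltW.
rewrite lerBlDr => le1.
have le2 : e * e <= e * ((B + 2) * P).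
  rewrite -expr2; apply: (le_trans le1); rewrite addrC.
  rewrite [(B + 2) * P]mulrDl [e * (_ + _)]mulrDr lerD // mulrC ler_wpM2l ?(ltW e_gt0) //.
  by rewrite ler_wpM2l.
move: le2; rewrite ler_pM2l // => le2.
by have := le_trans leE le2; rewrite ler_pM2r // lerD2l ler_nat.
Qed.
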